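(* Let $X$ be a non-degenerate real random variable such that $\varphi(t):=\log \mathbb{E}[e^{tX}]$ is finite for all $t\ge 0$. Let $\{X_{i,j}:(i,j)\in\mathbb{N}^2\}$ be independent copies of $X$, let $\{N_n\}_{n\in\mathbb{N}}$ be a sequence of natural numbers with $\lim_{n\to\infty}e^{-cn}N_n=1$ for some $c>0$, and let $Z_n=\sum_{i=1}^{N_n}\prod_{j=1}^n e^{X_{i,j}}$. Let $c_2:=2\varphi'(2)-\varphi(2)$ and assume that $c>c_2$. Then, as $n\to\infty$, $$\frac{Z_n-\mathbb{E}Z_n}{\sqrt{\operatorname{Var}Z_n}}\to \mathcal{N}(0,1)\quad\text{in distribution.}$$
   Context: $\mathcal{N}(0,\sigma^2)$ denotes the centered normal distribution with variance $\sigma^2$. Non-degenerate means not almost surely constant. Under the hypothesis on $\varphi$, the function $\varphi$ is infinitely differentiable on $(0,\infty)$. *)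

(* Defs.v *)
From HB Require Import structures.
From mathcomp Require Import all_boot all_order all_algebra finmap.
From mathcomp Require Import all_classical all_reals all_analysis.
From mathcomp Require Import measurable_realfun.

Set Implicit Arguments.
Unset Strict Implicit.
Unset Printing Implicit Defensive.

Import Order.TTheory GRing.Theory Num.Theory.
Import numFieldNormedType.Exports.
Local Open Scope classical_set_scope.
Local Open Scope ring_scope.

Definition non_degenerate (d : measure_display) (T : measurableType d)
    (R : realType) (P : probability T R) (X : {RV P >-> R}) : Prop :=
  ~ exists a : R, \forall w \ae P, X w = a.

Definition mutually_independent (d : measure_display) (T : measurableType d)
    (R : realType) (P : probability T R) (I : choiceType)
    (X : I -> {RV P >-> R}) : Prop :=
  forall (J : {fset I}) (A : I -> set R),
    (forall i, i \in J -> measurable (A i)) ->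
    P (\bigcap_(i in [set` J]) (X i @^-1` A i)) =
    (\prod_(i <- J) P (X i @^-1` A i))%E.

Definition same_law (d d' : measure_display) (T : measurableType d)
    (T' : measurableType d') (R : realType) (P : probability T R)
    (Q : probability T' R) (X : {RV P >-> R}) (Y : {RV Q >-> R}) : Prop :=
  forall A : set R, measurable A -> distribution P X A = distribution Q Y A.

(* The family may live on another probability space than X. *)
Definition independent_copies (d d' : measure_display) (T : measurableType d)
    (T' : measurableType d') (R : realType) (P : probability T R)
    (Q : probability T' R) (X : {RV P >-> R}) (I : choiceType)
    (Xs : I -> {RV Q >-> R}) : Prop :=
  mutually_independent Xs /\ forall i, same_law (Xs i) X.

(* Convergence of the distribution functions at every continuity point of the
   distribution function of the limit law mu. *)
Definition cvg_in_distribution (d : measure_display) (T : measurableType d)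
    (R : realType) (P : probability T R) (Y : nat -> {RV P >-> R})
    (mu : probability (measurableTypeR R) R) : Prop :=
  forall x : R, {for x, continuous (fun r : R => mu `]-oo, r]%classic)} ->
    cdf (Y n) x @[n --> \oo] --> mu `]-oo, x]%classic.
Arguments cvg_in_distribution {d T R} P Y mu.

Definition cumulant_gen_fun (d : measure_display) (T : measurableType d)
    (R : realType) (P : probability T R) (X : T -> R) (t : R) : \bar R :=
  lne (mmt_gen_fun P X t).

(* The indices i and j start at 0 instead of 1. *)
Definition sum_prod_exp (T : Type) (R : realType) (X : nat * nat -> T -> R)
    (N : nat -> nat) (n : nat) : T -> R :=
  fun w => \sum_(i < N n) \prod_(j < n) expR (X (i : nat, j : nat) w).

(* Division by zero is zero, so this is 0 when the variance vanishes; 'fine'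
   is harmless when Y has a finite second moment. *)
Definition standardize (d : measure_display) (T : measurableType d)
    (R : realType) (P : probability T R) (Y : T -> R) : T -> R :=
  fun w => (Y w - fine 'E_P[Y]) / Num.sqrt (fine (variance P Y)).

Section measurability.
Context (d : measure_display) (T : measurableType d) (R : realType)
  (P : probability T R).

Lemma measurable_sum_prod_exp (X : nat * nat -> {RV P >-> R}) N n :
  measurable_fun [set: T] (sum_prod_exp X N n).
Proof.
apply: measurable_sum => i; apply: measurable_prod => j _.
by apply: measurableT_comp => //; exact: measurable_funP.
Qed.

HB.instance Definition _ (X : nat * nat -> {RV P >-> R}) N n :=
  isMeasurableFun.Build _ _ T R (sum_prod_exp X N n)
    (measurable_sum_prod_exp X N n).

Lemma measurable_standardize (Y : {RV P >-> R}) :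
  measurable_fun [set: T] (standardize P Y).
Proof.
apply: measurable_funM => //; apply: measurable_funB => //.
Qed.

HB.instance Definition _ (Y : {RV P >-> R}) :=
  isMeasurableFun.Build _ _ T R (standardize P Y) (measurable_standardize Y).

End measurability.

(* Main.v *)
(* Lindeberg's swapping method under a Lyapunov condition.  Put M t = E[e^(tX)].
   The row Z_n is a sum of N_n independent variables W whose q-th moment is
   (M q)^n.  For q slightly larger than 2, Lyapunov's ratio
   N_n E|W - EW|^q / (N_n Var W)^(q/2) is of order
   exp(- n (c (q/2 - 1) + (q/2) phi(2) - phi(q))); since the exponent vanishes
   at q = 2, it is negative for some q > 2 because 2 phi'(2) - phi(2) < c.
   The Gaussian side is carried by the smoothing operators
   f |-> E[f(x + s G)], which preserve the second order Taylor bounds of a test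
   function; replacing the summands one at a time by normal variables of the
   same variance then costs only N_n (E|Y|^q + O(s^q)).  The test functions are
   logistic functions: all their derivatives are polynomials in the function
   itself, hence bounded, and steep ones approximate indicators of half-lines. *)
Require Import Defs.
From mathcomp Require Import all_boot all_order all_algebra finmap.
From mathcomp Require Import all_classical all_reals all_analysis.
From mathcomp Require Import measurable_realfun ring lra.
Import Order.TTheory GRing.Theory Num.Theory.
Import numFieldNormedType.Exports.
Local Open Scope classical_set_scope.
Local Open Scope ring_scope.

Set Implicit Arguments.
Unset Strict Implicit.
Unset Printing Implicit Defensive.

(** * Integrals of real functions *)

(** No normal variable is built on the probability space of the array: a swap turns the last summand
    into one more smoothing of the test function, so the summand need only be independent of the
    preceding partial sum. After [N n] swaps nothing random is left, and the composed smoothings, of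
    variance [1 / N n] each, collapse to one integral against the standard normal density.

    The exponent [q] is squeezed from two sides. The hypothesis [c2 < c] controls a derivative at
    [2], so it gives decay merely for some [q] near [2], and third moments may be too large. Bounded
    derivatives up to order three give a Taylor remainder of order [min(|h|^3, h^2)], which is at
    most [|h|^q] for every [q] between 2 and 3.

    Centering could spoil the ratio in two places. By non-degeneracy [M(1)^2 < M(2)] strictly; this
    keeps the variance [M(2)^n - M(1)^(2n)] comparable to [M(2)^n] and makes the contribution
    [M(1)^(nq)] of the mean negligible. The Gaussian share of the error is of order [N_n^(1 - q/2)],
    which vanishes because [c > 0]. *)

Section real_integrable.
Context (d : measure_display) (T : measurableType d) (R : realType)
  (mu : {measure set T -> \bar R}).
Implicit Types f g : T -> R.

Local Notation L1 f := (mu.-integrable [set: T] (EFin \o f)).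

Lemma L1_le f g : measurable_fun [set: T] f -> L1 g ->
  (forall x, `|f x| <= g x) -> L1 f.
Proof.
move=> mf ig fg; apply: (le_integrable _ _ _ ig) => //.
  exact/measurable_EFinP.
by move=> x _ /=; rewrite lee_fin (le_trans (fg x))// ler_norm.
Qed.

Lemma L1D f g : L1 f -> L1 g -> L1 (fun x => f x + g x).
Proof. by move=> If Ig; exact: (integrableD measurableT If Ig). Qed.

Lemma L1B f g : L1 f -> L1 g -> L1 (fun x => f x - g x).
Proof. by move=> If Ig; exact: (integrableB measurableT If Ig). Qed.

Lemma L1Zl (a : R) f : L1 f -> L1 (fun x => a * f x).
Proof. by move=> If; exact: (integrableZl measurableT a If). Qed.

Lemma L1_norm f : L1 f -> L1 (fun x => `|f x|).
Proof. exact: integrable_norm. Qed.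

Lemma L1_sum n (F : nat -> T -> R) : (forall i, (i < n)%N -> L1 (F i)) ->
  L1 (fun x => \sum_(i < n) F i x).
Proof.
move=> FL; have := @integrable_sum _ T R mu _ measurableT _ (index_enum 'I_n)
  xpredT (fun i => EFin \o F i) (fun i _ => FL i (ltn_ord i)).
by apply: eq_integrable => // x _ /=; rewrite sumEFin.
Qed.

Lemma Rint_eq f g : f =1 g -> \int[mu]_x f x = \int[mu]_x g x.
Proof. by move=> fg; apply: eq_Rintegral => x _. Qed.

Lemma Rint_le f g : L1 f -> L1 g -> (forall x, f x <= g x) ->
  \int[mu]_x f x <= \int[mu]_x g x.
Proof. by move=> If Ig fg; apply: le_Rintegral. Qed.

Lemma Rint_normr_le f g : L1 f -> L1 g -> (forall x, `|f x| <= g x) ->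
  `|\int[mu]_x f x| <= \int[mu]_x g x.
Proof.
move=> If Ig fg; apply: le_trans (le_normr_Rintegral _ If) _ => //.
by apply: Rint_le => //; exact: L1_norm.
Qed.

Lemma Rint_sum n (F : nat -> T -> R) : (forall i, (i < n)%N -> L1 (F i)) ->
  \int[mu]_x (\sum_(i < n) F i x) = \sum_(i < n) \int[mu]_x F i x.
Proof.
elim: n => [|n IH] FL.
  rewrite big_ord0 (@Rint_eq _ (fun=> 0)) => [|x]; last by rewrite big_ord0.
  by rewrite /Rintegral integral0.
rewrite big_ord_recr/= -IH => [|i /leqW]; last exact: FL.
rewrite -RintegralD//; last exact: FL.
  by apply: Rint_eq => x; rewrite big_ord_recr.
by apply: L1_sum => i /leqW; exact: FL.
Qed.

Lemma L1_EFin_int f : L1 f -> (\int[mu]_x f x)%:E = (\int[mu]_x (f x)%:E)%E.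
Proof. by move=> If; rewrite /Rintegral fineK//; exact: integrable_fin_num. Qed.

End real_integrable.

Lemma expR_normr_ge (R : realType) (y : R) : `|y| <= expR `|y|.
Proof. by have := @expR_ge1Dx R `|y|; lra. Qed.

Lemma expR_normr_le (R : realType) (y : R) : expR `|y| <= expR y + expR (- y).
Proof.
have := expR_gt0 y; have := expR_gt0 (- y).
by case: (ger0P y); lra.
Qed.

(** * Differentiation of exponential integrals under the integral sign *)

Section exponential_integral.
Context (d : measure_display) (T : measurableType d) (R : realType)
  (mu : {measure set T -> \bar R}) (w X : T -> R) (u v : R).
Hypothesis mw : measurable_fun [set: T] w.
Hypothesis mX : measurable_fun [set: T] X.
Hypothesis L1w : forall t, u < t < v ->
  mu.-integrable [set: T] (EFin \o (fun x => w x * expR (t * X x))).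

Let bound (t r a : R) x : 0 < r -> `|a - t| < r ->
  `|w x * (X x * expR (a * X x))| <=
  r^-1 * (`|w x * expR ((t + 2 * r) * X x)| +
          `|w x * expR ((t - 2 * r) * X x)|).
Proof.
move=> r0 atr; rewrite !normrM !(gtr0_norm (expR_gt0 _)) -mulrDr [leRHS]mulrCA.
apply: ler_wpM2l => //; rewrite ler_pdivlMl//.
have h1 : r * `|X x| <= expR (r * `|X x|).
  by have := @expR_ge1Dx R (r * `|X x|); lra.
have h2 : expR (a * X x) <= expR (t * X x) * expR (r * `|X x|).
  rewrite -expRD ler_expR -lerBlDl -mulrBl.
  by rewrite (le_trans (ler_norm _))// normrM ler_wpM2r// ltW.
rewrite mulrA (le_trans (ler_pM _ _ h1 h2))//.
  by rewrite mulr_ge0// ltW.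
rewrite mulrCA -expRD -mulrDl.
rewrite (_ : (r + r) * `|X x| = `|2 * r * X x|); last first.
  by rewrite normrM (gtr0_norm (_ : 0 < 2 * r)); lra.
apply: le_trans (ler_wpM2l (expR_ge0 _) (expR_normr_le _)) _.
rewrite mulrDr -!expRD le_eqVlt; apply/orP; left; apply/eqP.
by congr (expR _ + expR _); ring.
Qed.

Lemma exp_int_derive t : u < t < v ->
  mu.-integrable [set: T] (EFin \o (fun x => w x * X x * expR (t * X x))) /\
  is_derive t 1 (fun a => \int[mu]_x (w x * expR (a * X x)))
    (\int[mu]_x (w x * X x * expR (t * X x))).
Proof.
move=> /andP[ut tv].
(* A quarter of the distance to the ends keeps [t - 2r] and [t + 2r], where the dominating function
   is evaluated, inside the interval. *)
pose r := Num.min (t - u) (v - t) / 4.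
have r0 : 0 < r by rewrite divr_gt0// lt_min; lra.
have ru : 4 * r <= t - u by rewrite mulrC divfK// ge_min lexx.
have rv : 4 * r <= v - t by rewrite mulrC divfK// ge_min lexx orbT.
pose G x := r^-1 * (`|w x * expR ((t + 2 * r) * X x)| +
          `|w x * expR ((t - 2 * r) * X x)|).
have LG : mu.-integrable [set: T] (EFin \o G).
  by apply/L1Zl/L1D; apply/L1_norm/L1w; lra.
have dE a x : is_derive a (1 : R) (fun a => w x * expR (a * X x))
    (w x * (X x * expR (a * X x))).
  have h : is_derive a (1 : R) (fun a : R => a * X x) (X x).
    by apply: is_derive_eq; rewrite scaler0 add0r /GRing.scale/= mulr1.
  have h2 := @is_derive1_comp _ expR (fun a => a * X x) a _ _
    (is_derive_expR _) h.
  have h3 := is_deriveZ (w x) h2.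
  by apply: (is_derive_eq h3); rewrite /GRing.scale/= (mulrC (X x)).
have d1E a x : partial1of2 (fun a x => w x * expR (a * X x)) a x =
    w x * X x * expR (a * X x).
  by rewrite partial1of2E (@derive_val _ _ _ _ _ _ _ (dE a x)) mulrA.
have ga a x : `|a - t| < r -> `|w x * X x * expR (a * X x)| <= G x.
  by rewrite -mulrA; exact: bound.
have near_t a : a \in `](t - r), (t + r)[ -> `|a - t| < r.
  by rewrite in_itv/= => /andP[? ?]; rewrite ltr_norml; apply/andP; lra.
have tt : t \in `](t - r), (t + r)[ by rewrite in_itv/=; apply/andP; lra.
have L1a a : a \in `](t - r), (t + r)[ ->
    mu.-integrable [set: T] (EFin \o (fun x => w x * expR (a * X x))).
  by rewrite in_itv/= => /andP[? ?]; apply: L1w; lra.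
have G0 x : 0 <= G x by rewrite mulr_ge0// ?invr_ge0 ?addr_ge0// ltW.
have dn a x : a \in `](t - r), (t + r)[ -> setT x ->
  derivable ((fun a x => w x * expR (a * X x)) ^~ x) a 1.
  by move=> _ _; exact: (@ex_derive _ _ _ _ _ _ _ (dE a x)).
have Gub a x : a \in `](t - r), (t + r)[ -> setT x ->
  `|partial1of2 (fun a x => w x * expR (a * X x)) a x| <= G x.
  by move=> /near_t h _; rewrite d1E; exact: ga.
split.
  apply: L1_le LG _ => [|x].
    by apply: measurable_funM; [exact: measurable_funM|];
      apply: measurableT_comp => //; exact: measurable_funM.
  by apply: ga; rewrite subrr normr0.
apply: DeriveDef.
  exact: (derivable_under_integral measurableT tt L1a dn G0 LG Gub).
rewrite -derive1E.
rewrite (differentiation_under_integral measurableT tt L1a dn G0 LG Gub).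
by apply: Rint_eq => x; rewrite d1E.
Qed.
End exponential_integral.

(** * Gaussian smoothing *)

Section normal_smoothing.
Context {R : realType}.
Local Notation mu := (@lebesgue_measure R).
Local Notation L1 f := (mu.-integrable [set: R] (EFin \o f)).
Implicit Types (f g : R -> R) (s t x : R).

(** The image of Lebesgue measure under a translation gives half-open intervals their length, so it
    is Lebesgue measure by uniqueness. *)
Lemma ge0_integral_translation (g : R -> \bar R) x :
  measurable_fun [set: R] g -> (forall y, (0 <= g y)%E) ->
  (\int[mu]_y g (x + y)%R = \int[mu]_y g y)%E.
Proof.
move=> mg g0.
have mx : measurable_fun [set: R]
  ((fun y => x + y) : measurableTypeR R -> measurableTypeR R).
  exact: measurable_funD.
rewrite -[LHS](@ge0_integral_pushforward _ _ (measurableTypeR R)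
  (measurableTypeR R) R _ mx mu setT g)//.
apply: eq_measure_integral => A mA _; apply/esym/lebesgue_measure_unique => //.
move=> _ [[a b]] _ <- /=; rewrite /pushforward.
rewrite (_ : _ @^-1` _ = `](a - x), (b - x)]%classic); last first.
  by apply/seteqP; split=> y /=; rewrite !in_itv/= ltrBlDl lerBrDl.
rewrite !lebesgue_measure_itv/= !lte_fin ltrD2r -!EFinD.
by congr (if _ then _ else _); congr EFin; ring.
Qed.

Lemma normal_pdfV s x : s != 0 ->
  normal_pdf 0 s x = normal_peak s * expR (- x ^+ 2 / (s ^+ 2 *+ 2)).
Proof. by move=> s0; rewrite normal_pdfE//= /normal_fun subr0. Qed.

(** Disintegration of a Gaussian pair: the joint density of a summand [x] and the sum [z] is the
    density of [z] times the conditional density of [x] given [z]. The latter has mass 1, so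
    integrating [x] out yields the convolution formula. *)
Lemma normal_pdf_conv s t x z : 0 < s -> 0 < t ->
  normal_pdf 0 s x * normal_pdf 0 t (z - x) =
  normal_pdf 0 (Num.sqrt (s ^+ 2 + t ^+ 2)) z *
  normal_pdf (z * s ^+ 2 / (s ^+ 2 + t ^+ 2))
    (s * t / Num.sqrt (s ^+ 2 + t ^+ 2)) x.
Proof.
move=> s0 t0; set q := s ^+ 2 + t ^+ 2.
have q0 : 0 < q by rewrite addr_gt0// exprn_gt0.
have r0 : 0 < Num.sqrt q by rewrite sqrtr_gt0.
have rn0 := lt0r_neq0 r0; have sn0 := lt0r_neq0 s0; have tn0 := lt0r_neq0 t0.
have pi0 : 0 < pi :> R by exact: pi_gt0.
have v0 : s * t / Num.sqrt q != 0 by rewrite !mulf_neq0// invr_eq0.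
rewrite !normal_pdfV// (@normal_pdfE _ _ (s * t / _))//= /normal_fun.
rewrite mulrACA -expRD [RHS]mulrACA -expRD; congr (_ * _).
  rewrite /normal_peak -!invfM; congr (_^-1).
  rewrite -!sqrtrM; last 2 first.
  - by rewrite mulrn_wge0// mulr_ge0 ?sqr_ge0// ltW.
  - by rewrite mulrn_wge0// mulr_ge0 ?sqr_ge0// ltW.
  congr Num.sqrt; rewrite exprMn exprVn sqr_sqrtr ?ltW// exprMn.
  by field; rewrite lt0r_neq0.
congr expR; rewrite exprMn exprVn sqr_sqrtr ?ltW// exprMn.
by rewrite /q; field; rewrite sn0 tn0 lt0r_neq0.
Qed.

Lemma integral_normal_pdf_conv s t z : 0 < s -> 0 < t ->
  (\int[mu]_x (normal_pdf 0 s x * normal_pdf 0 t (z - x))%:E =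
   (normal_pdf 0 (Num.sqrt (s ^+ 2 + t ^+ 2)) z)%:E)%E.
Proof.
move=> s0 t0; under eq_integral do rewrite normal_pdf_conv// EFinM.
rewrite ge0_integralZl//=.
- by rewrite integral_normal_pdf mule1.
- apply: measurableT_comp => //. exact: measurable_normal_pdf.
- by move=> x _; rewrite lee_fin normal_pdf_ge0.
- by rewrite lee_fin normal_pdf_ge0.
Qed.

(** For nonnegative [g], Tonelli applies without integrability; the translation [z = x + y] brings
    the double integral into convolution form. *)
Lemma ge0_normal_conv g s t : 0 < s -> 0 < t ->
  measurable_fun [set: R] g -> (forall y, 0 <= g y) ->
  (\int[mu]_x ((\int[mu]_y (g (x + y) * normal_pdf 0 t y)%:E) *
               (normal_pdf 0 s x)%:E) =
  \int[mu]_z (g z * normal_pdf 0 (Num.sqrt (s ^+ 2 + t ^+ 2)) z)%:E)%E.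
Proof.
move=> s0 t0 mg g0.
have mn m v : measurable_fun [set: R] (@normal_pdf R m v).
  exact: measurable_normal_pdf.
have n0 m v x : 0 <= @normal_pdf R m v x by exact: normal_pdf_ge0.
pose F (xz : R * R) :=
  (g xz.2 * normal_pdf 0 t (xz.2 - xz.1) * normal_pdf 0 s xz.1)%:E.
have mF : measurable_fun [set: R * R] F.
  apply/measurable_EFinP/measurable_funM; last exact: measurableT_comp.
  apply: measurable_funM; first exact: measurableT_comp.
  by apply: measurableT_comp => //; exact: measurable_funB.
have F0 xz : (0 <= F xz)%E by rewrite lee_fin !mulr_ge0.
transitivity (\int[mu]_x \int[mu]_z F (x, z))%E.
  apply: eq_integral => x _.
  rewrite -(@ge0_integral_translation (fun z => F (x, z)) x)//; last first.
    exact: measurableT_comp.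
  rewrite -ge0_integralZr//=.
  - by apply: eq_integral => y _; rewrite /F/= -EFinM addrAC subrr add0r.
  - apply/measurable_EFinP/measurable_funM; last exact: mn.
    by apply: measurableT_comp => //; exact: measurable_funD.
  - by move=> y _; rewrite lee_fin mulr_ge0.
  - by rewrite lee_fin.
rewrite fubini_tonelli//; apply: eq_integral => z _.
rewrite /F/=; under eq_integral do rewrite -mulrA EFinM (mulrC (normal_pdf _ _ _)).
rewrite ge0_integralZl//=.
- by rewrite integral_normal_pdf_conv// EFinM.
- apply/measurable_EFinP/measurable_funM; first exact: mn.
  by apply: measurableT_comp => //; exact: measurable_funB.
- by move=> x _; rewrite lee_fin mulr_ge0.
- by rewrite lee_fin.
Qed.

End normal_smoothing.

(** * Moments of the centered normal density *)

Section normal_moments.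
Context {R : realType}.
Local Notation mu := (@lebesgue_measure R).
Local Notation L1 f := (mu.-integrable [set: R] (EFin \o f)).
Implicit Types (f g : R -> R) (s t x : R).

Lemma measurable_mulr_cst (a : R) : measurable_fun [set: R] (fun y : R => a * y).
Proof. exact: measurable_funM. Qed.

(* Completing the square: an exponential tilt of a centered normal density is a
   shifted normal density; all moments below are read off its total mass. *)
Lemma normal_pdf_tilt s t y : s != 0 -> normal_pdf 0 s y * expR (t * y) =
  expR (s ^+ 2 * t ^+ 2 / 2) * normal_pdf (s ^+ 2 * t) s y.
Proof.
move=> s0; rewrite normal_pdfV// normal_pdfE//= /normal_fun.
rewrite -[LHS]mulrA -expRD [RHS]mulrCA -expRD; congr (_ * expR _).
by field.
Qed.

Lemma L1_normal_pdf m s : L1 (@normal_pdf R m s).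
Proof. exact: integrable_normal_pdf. Qed.

Lemma Rint_normal_pdf m s : \int[mu]_x (@normal_pdf R m s x) = 1.
Proof. by rewrite /Rintegral integral_normal_pdf. Qed.

Lemma L1_normal_mgf s t : s != 0 ->
  L1 (fun y => normal_pdf 0 s y * expR (t * y)).
Proof.
move=> s0.
rewrite (_ : (fun _ => _) =
  (fun y => expR (s ^+ 2 * t ^+ 2 / 2) * normal_pdf (s ^+ 2 * t) s y)).
  by apply: L1Zl; exact: L1_normal_pdf.
by apply/funext => y; exact: normal_pdf_tilt.
Qed.

Lemma normal_mgf s t : s != 0 ->
  \int[mu]_y (normal_pdf 0 s y * expR (t * y)) = expR (s ^+ 2 * t ^+ 2 / 2).
Proof.
move=> s0; under eq_Rintegral do rewrite normal_pdf_tilt//.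
by rewrite RintegralZl//; [rewrite Rint_normal_pdf mulr1|exact: L1_normal_pdf].
Qed.

(** The moments are the first two derivatives at [0] of [exp(s^2 t^2 / 2)], obtained from
    [exp_int_derive] with the density as weight and then with the density times [y]. *)
Lemma normal_moments s : s != 0 ->
  [/\ L1 (fun y => normal_pdf 0 s y * y),
      L1 (fun y => normal_pdf 0 s y * y * y),
      \int[mu]_y (normal_pdf 0 s y * y) = 0 &
      \int[mu]_y (normal_pdf 0 s y * y * y) = s ^+ 2].
Proof.
move=> s0.
have mid : measurable_fun [set: R] (id : R -> R) by [].
have mp : measurable_fun [set: R] (@normal_pdf R 0 s).
  exact: measurable_normal_pdf.
have D1 (t : R) := @exp_int_derive _ _ _ mu _ _ (t - 1) (t + 1) mp mid
  (fun a _ => L1_normal_mgf a s0) t.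
have D1t (t : R) : t - 1 < t < t + 1 by lra.
have mp1 : measurable_fun [set: R] (fun y => @normal_pdf R 0 s y * y).
  exact: measurable_funM.
have D2 (t : R) := @exp_int_derive _ _ _ mu _ _ (t - 1) (t + 1) mp1 mid
  (fun a _ => (D1 a (D1t a)).1) t.
have F1 (t : R) : \int[mu]_y (normal_pdf 0 s y * y * expR (t * y)) =
    s ^+ 2 * t * expR (s ^+ 2 * t ^+ 2 / 2).
  have := (D1 t (D1t t)).2 => /@derive_val <-.
  rewrite (_ : (fun a => _) = (fun a => expR (s ^+ 2 * a ^+ 2 / 2))); last first.
    by apply/funext => a; exact: normal_mgf.
  have h : is_derive t (1 : R) (fun a : R => s ^+ 2 * a ^+ 2 / 2) (s ^+ 2 * t).
    by apply: is_derive_eq; rewrite /GRing.scale/= !mulr0 add0r; field.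
  rewrite (@derive_val _ _ _ _ _ _ _ (@is_derive1_comp _ expR _ t _ _
    (is_derive_expR _) h)).
  by rewrite mulrC.
have F2 : \int[mu]_y (normal_pdf 0 s y * y * y * expR (0 * y)) = s ^+ 2.
  have := (D2 0 (D1t 0)).2 => /@derive_val <-.
  rewrite (_ : (fun a => _) =
      (fun a => s ^+ 2 * a * expR (s ^+ 2 * a ^+ 2 / 2))); last first.
    by apply/funext => a; exact: F1.
  have h : is_derive 0 (1 : R) (fun a : R => s ^+ 2 * a ^+ 2 / 2) (s ^+ 2 * 0).
    by apply: is_derive_eq; rewrite /GRing.scale/= !(mul0r, mulr0, addr0).
  have h2 := @is_derive1_comp _ expR _ 0 _ _ (is_derive_expR _) h.
  have h3 : is_derive 0 (1 : R) (fun a : R => s ^+ 2 * a) (s ^+ 2).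
    by apply: is_derive_eq; rewrite /GRing.scale/=; ring.
  have h4 := is_deriveM h3 h2.
  rewrite (@derive_val _ _ _ _ _ _ _ h4) /GRing.scale/=.
  by rewrite expr0n/= !(mulr0, mul0r) add0r expR0 mul1r.
have e0 y : expR (0 * y) = 1 :> R by rewrite mul0r expR0.
split.
- by have := (D1 0 (D1t 0)).1; under eq_fun do rewrite /= e0 mulr1.
- by have := (D2 0 (D1t 0)).1; under eq_fun do rewrite /= e0 mulr1.
- have := F1 0; rewrite mulr0 mul0r.
  by under eq_Rintegral do rewrite e0 mulr1.
- by have := F2; under eq_Rintegral do rewrite e0 mulr1.
Qed.

(** From [|u| <= exp |u|] with [u = y / s], the power [|u|^q] is at most [exp(q u) + exp(- q u)].
    Each exponential has Gaussian integral [exp(q^2 / 2)], whence the constant. *)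
Lemma normal_abs_moment s q : 0 < s -> 0 <= q ->
  L1 (fun y => `|y| `^ q * normal_pdf 0 s y) /\
  \int[mu]_y (`|y| `^ q * normal_pdf 0 s y) <=
    2 * expR (q ^+ 2 / 2) * s `^ q.
Proof.
move=> s0 q0; have sn0 := lt0r_neq0 s0.
pose G y := s `^ q * (normal_pdf 0 s y * expR (q / s * y) +
                     normal_pdf 0 s y * expR (- (q / s) * y)).
have LG : L1 G by apply/L1Zl/L1D; exact: L1_normal_mgf.
have leG y : `|(`|y| `^ q * normal_pdf 0 s y)| <= G y.
  rewrite ger0_norm; last by rewrite mulr_ge0 ?powR_ge0 ?normal_pdf_ge0.
  rewrite /G -mulrDr mulrA mulrAC; apply: ler_wpM2r.
    exact: normal_pdf_ge0.
  rewrite (_ : `|y| = s * `|y / s|); last first.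
    by rewrite normrM normfV (gtr0_norm s0) mulrCA divff// mulr1.
  rewrite powRM// ?(ltW s0)//; apply: ler_wpM2l; first exact: powR_ge0.
  apply: (@le_trans _ _ (expR `|y / s| `^ q)).
    by apply: ge0_ler_powR; rewrite ?nnegrE ?expR_ge0// expR_normr_ge.
  rewrite -expRM mulrC (_ : q * `|y / s| = `|q / s * y|); last first.
    by rewrite -{1}(ger0_norm q0) -normrM; congr `|_|; field.
  by rewrite (le_trans (expR_normr_le _))// mulNr.
have mf : measurable_fun [set: R] (fun y : R => `|y| `^ q * normal_pdf 0 s y).
  apply: measurable_funM; last exact: measurable_normal_pdf.
  by apply: (measurableT_comp (measurable_powR q)); exact: normr_measurable.
have Lf : L1 (fun y => `|y| `^ q * normal_pdf 0 s y) by exact: L1_le LG leG.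
split => //.
apply: (@le_trans _ _ (\int[mu]_y G y)).
  by apply: Rint_le => // y; exact: le_trans (ler_norm _) (leG y).
rewrite RintegralZl//; last by apply/L1D; exact: L1_normal_mgf.
rewrite RintegralD//; [|exact: L1_normal_mgf|exact: L1_normal_mgf].
rewrite !normal_mgf// sqrrN.
rewrite (_ : s ^+ 2 * (q / s) ^+ 2 / 2 = q ^+ 2 / 2); last by field.
by rewrite le_eqVlt; apply/orP; left; apply/eqP; ring.
Qed.

End normal_moments.

(** * Smoothing operators and their effect on Taylor bounds *)

Section smoothing.
Context {R : realType}.
Local Notation mu := (@lebesgue_measure R).
Local Notation L1 f := (mu.-integrable [set: R] (EFin \o f)).
Implicit Types (f g : R -> R) (s t x : R).

(** A class stable under smoothing with an unchanged constant: the Lipschitz bound gives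
    measurability and the uniform bound gives integrability against any probability. *)
Definition bounded_lipschitz (K : R) f :=
  (forall x, `|f x| <= K) /\ (forall x y, `|f x - f y| <= K * `|x - y|).

Lemma bounded_lipschitz_ge0 K f : bounded_lipschitz K f -> 0 <= K.
Proof. by case=> fK _; rewrite (le_trans _ (fK 0)). Qed.

Lemma bounded_lipschitz_measurable K f : bounded_lipschitz K f ->
  measurable_fun [set: R] f.
Proof.
move=> fK; have K0 := bounded_lipschitz_ge0 fK; case: fK => _ fK.
apply: continuous_measurable_fun => x; apply/cvgrPdist_lt => e e0.
have K1 : 0 < K + 1 by lra.
near=> y; apply: le_lt_trans (fK _ _) _.
apply: (@le_lt_trans _ _ ((K + 1) * `|x - y|)).
  by apply: ler_wpM2r => //; lra.
rewrite -ltr_pdivlMl//; near: y.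
by apply: cvgr_dist_lt; rewrite ?mulr_gt0 ?invr_gt0.
Unshelve. all: end_near. Qed.

Lemma bounded_lipschitz_shift K f x : bounded_lipschitz K f ->
  bounded_lipschitz K (fun y => f (x + y)).
Proof.
move=> [fK fL]; split=> // y z; rewrite (le_trans (fL _ _))//.
by rewrite opprD addrACA subrr add0r.
Qed.

Lemma L1_bounded_normal K f s : measurable_fun [set: R] f ->
  (forall x, `|f x| <= K) -> L1 (fun y => f y * normal_pdf 0 s y).
Proof.
move=> mf fK; have mp := @measurable_normal_pdf R 0 s.
apply: (@L1_le _ _ _ mu _ (fun y => K * normal_pdf 0 s y)).
- exact: measurable_funM.
- by apply: L1Zl; exact: L1_normal_pdf.
- move=> y; rewrite normrM (ger0_norm (normal_pdf_ge0 _ _ _)).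
  by rewrite ler_wpM2r// normal_pdf_ge0.
Qed.

Definition normal_smooth s f x := \int[mu]_y (f (x + y) * normal_pdf 0 s y).

Lemma L1_smooth K f s x : bounded_lipschitz K f ->
  L1 (fun y => f (x + y) * normal_pdf 0 s y).
Proof.
move=> fK; apply: (@L1_bounded_normal K (fun y => f (x + y))).
  exact: bounded_lipschitz_measurable (bounded_lipschitz_shift x fK).
by move=> y; exact: fK.1.
Qed.

Lemma Rint_normal_bound K f s : L1 (fun y => f y * normal_pdf 0 s y) ->
  (forall y, `|f y| <= K) -> `|\int[mu]_y (f y * normal_pdf 0 s y)| <= K.
Proof.
move=> If fK.
have -> : K = \int[mu]_y (K * normal_pdf 0 s y).
  rewrite RintegralZl//; last exact: L1_normal_pdf.
  by rewrite Rint_normal_pdf mulr1.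
apply: Rint_normr_le => //.
  by apply: L1Zl; exact: L1_normal_pdf.
move=> y; rewrite normrM (ger0_norm (normal_pdf_ge0 _ _ _)).
by rewrite ler_wpM2r// normal_pdf_ge0.
Qed.

Lemma bounded_lipschitz_smooth K f s : bounded_lipschitz K f ->
  bounded_lipschitz K (normal_smooth s f).
Proof.
move=> fK; split=> [x|x z].
  by apply: (@Rint_normal_bound K (fun y => f (x + y)));
    [exact: L1_smooth fK|move=> y; exact: fK.1].
rewrite /normal_smooth -RintegralB//; [|exact: L1_smooth fK..].
under eq_Rintegral do rewrite -mulrBl.
apply: (@Rint_normal_bound _ (fun y => f (x + y) - f (z + y))).
  under eq_fun do rewrite /= mulrBl.
  by apply: L1B; exact: L1_smooth fK.
move=> y; rewrite (le_trans (fK.2 _ _))//.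
by rewrite opprD addrACA subrr addr0.
Qed.

Lemma normal_smoothD_cst s K c f x : bounded_lipschitz K f ->
  normal_smooth s (fun y => f y + c) x = normal_smooth s f x + c.
Proof.
move=> fK; rewrite /normal_smooth; under eq_Rintegral do rewrite mulrDl.
rewrite RintegralD//.
- by rewrite RintegralZl ?Rint_normal_pdf ?mulr1//; exact: L1_normal_pdf.
- exact: L1_smooth fK.
- by apply: L1Zl; exact: L1_normal_pdf.
Qed.

Lemma ge0_normal_smooth_comp s t K f x : 0 < s -> 0 < t ->
  bounded_lipschitz K f -> (forall y, 0 <= f y) ->
  normal_smooth s (normal_smooth t f) x =
  normal_smooth (Num.sqrt (s ^+ 2 + t ^+ 2)) f x.
Proof.
move=> s0 t0 fK f0; rewrite {1 3}/normal_smooth /Rintegral; congr fine.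
rewrite -(ge0_normal_conv (g := fun y => f (x + y)) s0 t0)//; last first.
  exact: bounded_lipschitz_measurable (bounded_lipschitz_shift x fK).
apply: eq_integral => y _; rewrite EFinM; congr (_ * _)%E.
rewrite /normal_smooth L1_EFin_int; last exact: L1_smooth fK.
by apply: eq_integral => z _; rewrite addrA.
Qed.

(** Reduced to the nonnegative case by adding [K] to [f]; smoothing commutes with adding a constant,
    so [K] cancels at the end. *)
Lemma normal_smooth_comp s t K f x : 0 < s -> 0 < t ->
  bounded_lipschitz K f ->
  normal_smooth s (normal_smooth t f) x =
  normal_smooth (Num.sqrt (s ^+ 2 + t ^+ 2)) f x.
Proof.
move=> s0 t0 fK.
have K0 := bounded_lipschitz_ge0 fK.
have f'K : bounded_lipschitz (K + K) (fun y => f y + K).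
  split=> [y|y z].
    by have := fK.1 y; rewrite !ler_norml => /andP[? ?]; apply/andP; lra.
  rewrite opprD addrACA subrr addr0 (le_trans (fK.2 y z))//.
  by rewrite ler_wpM2r// lerDl.
have f'0 y : 0 <= f y + K.
  by have := fK.1 y; rewrite ler_norml => /andP[? ?]; lra.
have := ge0_normal_smooth_comp x s0 t0 f'K f'0.
rewrite (normal_smoothD_cst _ _ _ fK).
rewrite (_ : normal_smooth t (fun y => f y + K) =
    (fun y => normal_smooth t f y + K)); last first.
  by apply/funext => y; rewrite (normal_smoothD_cst _ _ _ fK).
rewrite (normal_smoothD_cst _ _ _ (bounded_lipschitz_smooth t fK)).
exact: addIr.
Qed.

(** Variances add under composition. The count starts at one smoothing because the identity is not
    integration against a density. *)
Lemma normal_smooth_iter s K f n x : 0 < s -> bounded_lipschitz K f ->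
  iter n.+1 (normal_smooth s) f x = normal_smooth (Num.sqrt n.+1%:R * s) f x.
Proof.
move=> s0 fK; elim: n x => [|n IH] x; first by rewrite /= sqrtr1 mul1r.
rewrite iterS (_ : iter n.+1 _ _ = normal_smooth (Num.sqrt n.+1%:R * s) f).
  rewrite (normal_smooth_comp _ _ _ fK)//; last by rewrite mulr_gt0 ?sqrtr_gt0.
  congr (normal_smooth _ f x); rewrite exprMn sqr_sqrtr// -{1}(mul1r (s ^+ 2)).
  rewrite -mulrDl sqrtrM ?addr_ge0// sqrtr_sqr (gtr0_norm s0).
  by rewrite nat1r.
by apply/funext => y; exact: IH.
Qed.

(** The functions [f1] and [f2] are data tied to [f0] by the expansion instead of being its
    derivatives. The condition is thus linear in the triple and passes to averages of translates
    without differentiating an integral. *)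
Definition taylor2 (q K : R) (f0 f1 f2 : R -> R) :=
  [/\ bounded_lipschitz K f0, bounded_lipschitz K f1, bounded_lipschitz K f2 &
    forall x h, `|f0 (x + h) - f0 x - h * f1 x - h ^+ 2 / 2 * f2 x| <=
      K * `|h| `^ q].

Lemma taylor2_smooth q K f0 f1 f2 s : taylor2 q K f0 f1 f2 ->
  taylor2 q K (normal_smooth s f0) (normal_smooth s f1) (normal_smooth s f2).
Proof.
move=> [B0 B1 B2 ft]; split; [exact: bounded_lipschitz_smooth..|move=> x h].
have I0 z := L1_smooth s z B0.
have I1 z := L1_smooth s z B1.
have I2 z := L1_smooth s z B2.
rewrite /normal_smooth -!RintegralZl// -!RintegralB//.
- pose F y := f0 (x + h + y) - f0 (x + y) - h * f1 (x + y) -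
    h ^+ 2 / 2 * f2 (x + y).
  under eq_Rintegral do rewrite !mulrA -!mulrBl.
  apply: (@Rint_normal_bound _ F).
    rewrite (_ : (fun y => _) = (fun y =>
      f0 (x + h + y) * normal_pdf 0 s y - f0 (x + y) * normal_pdf 0 s y -
      h * (f1 (x + y) * normal_pdf 0 s y) -
      h ^+ 2 / 2 * (f2 (x + y) * normal_pdf 0 s y))); last first.
      by apply/funext => y; rewrite /F; ring.
    by apply: L1B; [apply: L1B; [exact: L1B|exact: L1Zl]|exact: L1Zl].
  move=> y; rewrite /F.
  by rewrite (addrAC x h y); exact: ft.
- by apply: L1B; [exact: L1B|exact: L1Zl].
- exact: L1Zl.
- exact: L1B.
- exact: L1Zl.
Qed.

(** The expansion at [x] is integrated against the density: the first moment kills the [f1] term,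
    the second produces [s ^+ 2], and the remainder costs one absolute moment of order [q]. *)
Lemma normal_smooth_approx q K f0 f1 f2 s x : 0 < s -> 0 <= q ->
  taylor2 q K f0 f1 f2 ->
  `|normal_smooth s f0 x - f0 x - s ^+ 2 / 2 * f2 x| <=
    K * (2 * expR (q ^+ 2 / 2) * s `^ q).
Proof.
move=> s0 q0 [B0 B1 B2 ft].
have K0 := bounded_lipschitz_ge0 B0.
have [M1 M2 m1 m2] := normal_moments (lt0r_neq0 s0).
have [Lq leq] := normal_abs_moment s0 q0.
have I0 := L1_smooth s x B0.
have Ip := @L1_normal_pdf R 0 s.
apply: (@le_trans _ _ (\int[mu]_y (K * (`|y| `^ q * normal_pdf 0 s y)))); last first.
  by rewrite RintegralZl// ler_wpM2l.
rewrite (_ : _ - _ = \int[mu]_y (f0 (x + y) * normal_pdf 0 s y -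
    f0 x * normal_pdf 0 s y - f1 x * (normal_pdf 0 s y * y) -
    f2 x / 2 * (normal_pdf 0 s y * y * y))).
  apply: Rint_normr_le.
  - by apply: L1B; [apply: L1B; [apply: L1B => //|]|]; apply: L1Zl.
  - exact: L1Zl.
  move=> y.
  rewrite mulrA -[X in _ <= _ * X](ger0_norm (normal_pdf_ge0 0 s y)).
  rewrite (_ : _ - _ = (f0 (x + y) - f0 x - y * f1 x - y ^+ 2 / 2 * f2 x) *
    normal_pdf 0 s y); last by field.
  by rewrite normrM ler_wpM2r.
rewrite !RintegralB//.
- rewrite !RintegralZl// Rint_normal_pdf m1 m2 -/(normal_smooth s f0 x).
  by field.
- exact: L1Zl.
- by apply: L1B => //; exact: L1Zl.
- exact: L1Zl.
- by apply: L1B; [apply: L1B => //|]; apply: L1Zl.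
- exact: L1Zl.
Qed.

End smoothing.

(** * Independence *)

Section independence.
Context (d : measure_display) (T : measurableType d) (R : realType)
  (Q : probability T R).
Local Notation L1 f := (Q.-integrable [set: T] (EFin \o f)).

Definition indep_events (S S' : set T) := Q (S `&` S') = (Q S * Q S')%E.

Definition indep (U V : T -> R) := forall A B, measurable A -> measurable B ->
  indep_events (U @^-1` A) (V @^-1` B).

Lemma lambda_system_indep (E : set T) : measurable E ->
  lambda_system setT [set S | measurable S /\ indep_events S E].
Proof.
move=> mE.
have fE (A : set T) : measurable A -> Q A \is a fin_num.
  by move=> mA; exact: fin_num_measure.
split=> //.
- by split=> //; rewrite /indep_events setTI probability_setT mul1e.
- move=> A B BA [mA iA] [mB iB]; split; first exact: measurableD.
  rewrite /indep_events setIDAC setIDA measureD//; last 2 first.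
  + exact: measurableI.
  + by rewrite ltey_eq fE//; exact: measurableI.
  rewrite measureD//; last by rewrite ltey_eq fE.
  rewrite (setIidr BA) setIAC (setIidr BA).
  rewrite muleBl; [|exact: fE|by rewrite fin_num_adde_defr// fE].
  by congr (_ - _)%E; [exact: iA|exact: iB].
- move=> F ndF GF; have mF i : measurable (F i) by have [] := GF i.
  have mU : measurable (\bigcup_i F i) by exact: bigcup_measurable.
  split=> //; rewrite /indep_events setI_bigcupl.
  have ndFE : {homo (fun i => F i `&` E) : n m / (n <= m)%N >-> (n <= m)%O}.
    by move=> n m nm; apply/subsetPset; apply: setSI; apply/subsetPset; exact: ndF.
  have mFE i : measurable (F i `&` E) by exact: measurableI.
  have c1 := nondecreasing_cvg_mu (mu := Q) mFE
    (bigcup_measurable (fun i _ => mFE i)) ndFE.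
  have c2 := nondecreasing_cvg_mu (mu := Q) mF mU ndF.
  have c3 : (Q (F i `&` E) @[i --> \oo] --> Q (\bigcup_i F i) * Q E)%E.
    rewrite (_ : (fun i => _) = (fun i => Q (F i) * Q E)%E).
      by apply: cvgeZr => //; exact: fE.
    by apply/funext => i; have [_] := GF i.
  exact: (cvg_unique _ c1 c3).
Qed.

(** Dynkin's argument run twice: a set of [H] is frozen while [G] is extended to its sigma-algebra,
    then a set of that sigma-algebra is frozen while [H] is extended. *)
Lemma indep_g_sigma (G H : set (set T)) : setI_closed G -> setI_closed H ->
  G `<=` measurable -> H `<=` measurable ->
  (forall S S', G S -> H S' -> indep_events S S') ->
  forall S S', <<s G >> S -> <<s H >> S' -> indep_events S S'.
Proof.
move=> GI HI Gm Hm GH.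
have sGm : <<s G >> `<=` measurable.
  by apply: smallest_sub => //; exact: sigma_algebra_measurable.
have step1 S S' : <<s G >> S -> H S' -> indep_events S S'.
  move=> GS HS'.
  have sub : <<s G >> `<=` [set A | measurable A /\ indep_events A S'].
    apply: (lambda_system_subset GI (lambda_system_indep (Hm _ HS'))) => //.
    by move=> A GA; split; [exact: Gm|exact: GH].
  by have [] := sub _ GS.
move=> S S' GS HS'.
have sub : <<s H >> `<=` [set A | measurable A /\ indep_events A S].
  apply: (lambda_system_subset HI (lambda_system_indep (sGm _ GS))) => //.
  move=> A HA; split; first exact: Hm.
  by rewrite /indep_events setIC muleC; exact: step1.
by have [_] := sub _ HS'; rewrite /indep_events setIC muleC.
Qed.

Section expectation.
Variables U V : T -> R.
Hypotheses (mU : measurable_fun [set: T] U) (mV : measurable_fun [set: T] V).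
Hypothesis UV : indep U V.
Hypotheses (IU : L1 U) (IV : L1 V).

Let U' : {RV Q >-> R} := mfun_Sub (mem_set mU).
Let V' : {RV Q >-> R} := mfun_Sub (mem_set mV).

Let mW : measurable_fun [set: T] (fun w => (U w, V w)).
Proof. exact/measurable_fun_pairP. Qed.

Let W : {RV Q >-> (R * R)%type} := mfun_Sub (mem_set mW).

(** Independence says that the joint law agrees with the product law on rectangles, and these
    determine a product measure. Fubini then factors expectations. *)
Let prodE (A : set (R * R)) : measurable A ->
  (distribution Q U' \x distribution Q V')%E A = distribution Q W A.
Proof.
by apply: product_measure_unique => B C mB mC; exact: UV.
Qed.

Let f (z : R * R) : \bar R := (z.1 * z.2)%:E.

Let mf : measurable_fun [set: R * R] f.
Proof. exact/measurable_EFinP/measurable_funM. Qed.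

Let IdU : (distribution Q U').-integrable [set: R] (EFin \o id).
Proof. by apply: integrable_pushforward => //; exact/measurable_EFinP. Qed.

Let IdV : (distribution Q V').-integrable [set: R] (EFin \o id).
Proof. by apply: integrable_pushforward => //; exact/measurable_EFinP. Qed.

Let intf : (distribution Q U' \x distribution Q V')%E.-integrable [set: R * R] f.
Proof.
apply/(integrable12ltyP _ _ mf); rewrite /f.
under eq_integral do under eq_integral do rewrite /= normrM EFinM.
under eq_integral => x _.
  rewrite ge0_integralZl//; last exact/measurable_EFinP.
  over.
have /integrableP[_ iV] := IdV; have /integrableP[_ iU] := IdU.
rewrite ge0_integralZr//.
- apply: lte_mul_pinfty => //.
  + exact: integral_ge0.
  + by rewrite ge0_fin_numE//; exact: integral_ge0.
- exact/measurable_EFinP.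
- exact: integral_ge0.
Qed.

Lemma L1_indepM : L1 (fun w => U w * V w).
Proof.
apply/integrableP; split.
  by apply/measurable_EFinP; exact: measurable_funM.
have /integrableP[_] := intf.
rewrite (eq_measure_integral (distribution Q W)); last first.
  by move=> A mA _; exact: prodE.
by rewrite ge0_integral_distribution//; exact: measurableT_comp.
Qed.

Lemma Rint_indepM :
  \int[Q]_w (U w * V w) = (\int[Q]_w U w) * (\int[Q]_w V w).
Proof.
rewrite /Rintegral.
have -> : (\int[Q]_w (U w * V w)%:E = \int[distribution Q W]_z f z)%E.
  by rewrite integral_distribution//; exact: L1_indepM.
rewrite -(eq_measure_integral (distribution Q W) (fun A mA _ => prodE mA)).
have inner x : (\int[distribution Q V']_y (x * y)%:E =
    (x * \int[Q]_w V w)%:E)%E.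
  under eq_integral do rewrite EFinM.
  rewrite (integralZl measurableT IdV).
  rewrite [X in (_ * X)%E]integral_distribution//; last exact/measurable_EFinP.
  by rewrite EFinM L1_EFin_int.
rewrite -integral12_prod_meas1// /fubini_F /f.
transitivity (fine (\int[distribution Q U']_x (x * \int[Q]_w V w)%:E)%E).
  by congr fine; apply: eq_integral => x _; exact: inner.
rewrite integral_distribution//=.
- by rewrite -/(Rintegral _ _ _) RintegralZr.
- exact/measurable_EFinP/measurable_funM.
- have := L1Zl (\int[Q]_w V w) IU.
  by apply: eq_integrable => // w _ /=; rewrite mulrC.
Qed.

End expectation.

(** * Independence of disjoint blocks of an independent family *)

Section blocks.
Context (I : choiceType) (X : I -> {RV Q >-> R}).
Hypothesis Xind : mutually_independent X.
Implicit Types (J K : {fset I}).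

(** All cylinders over [J] constrain the same indices, a free index being given the full set;
    intersections are then taken index by index. *)
Definition cylinder J : set (set T) := [set S | exists A : I -> set R,
  (forall i, measurable (A i)) /\ S = \bigcap_(i in [set` J]) (X i @^-1` A i)].

Lemma cylinder_measurable J : cylinder J `<=` measurable.
Proof.
move=> _ [A [mA ->]]; apply: fin_bigcap_measurable.
  exact: finite_fset.
by move=> i _; rewrite -[X in measurable X]setTI; exact: measurable_funP.
Qed.

Lemma cylinder_setI J : setI_closed (cylinder J).
Proof.
move=> _ _ [A [mA ->]] [B [mB ->]]; exists (fun i => A i `&` B i); split.
  by move=> i; exact: measurableI.
by rewrite -bigcapI.
Qed.

(** The two families of sets are glued into one family [C] over the union; mutual independence is
    applied to [J], [K] and their union, and the product over the union splits. *)
Lemma cylinder_indep J K S S' : [disjoint J & K]%fset ->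
  cylinder J S -> cylinder K S' -> indep_events S S'.
Proof.
move=> JK [A [mA ->]] [B [mB ->]].
pose C i := if i \in J then A i else B i.
have CJ i : i \in J -> C i = A i by rewrite /C => ->.
have CK i : i \in K -> C i = B i.
  by move=> iK; rewrite /C ifN//; apply: contraTN iK => /(fdisjointP JK).
have mC i : measurable (C i) by rewrite /C; case: ifP.
have e1 : \bigcap_(i in [set` J]) (X i @^-1` A i) =
    \bigcap_(i in [set` J]) (X i @^-1` C i).
  by apply: eq_bigcapr => i /= iJ; rewrite CJ.
have e2 : \bigcap_(i in [set` K]) (X i @^-1` B i) =
    \bigcap_(i in [set` K]) (X i @^-1` C i).
  by apply: eq_bigcapr => i /= iK; rewrite CK.
rewrite /indep_events e1 e2 -bigcap_setU.
rewrite -[X in \bigcap_(i in X) _](_ : [set` (J `|` K)%fset] = _); last first.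
  by rewrite set_fsetU.
rewrite !Xind//.
rewrite -big_cat; apply: perm_big; apply: uniq_perm.
- exact: fset_uniq.
- rewrite cat_uniq !fset_uniq/= andbT.
  by apply/hasPn => i iK; apply: contraTN iK => /(fdisjointP JK).
- by move=> i; rewrite mem_cat in_fsetU.
Qed.

(* [adapted J U]: U is measurable with respect to the sigma-algebra generated by
   the X_i with i in J, whose generating pi-system is [cylinder J]. *)
Definition adapted J (U : T -> R) :=
  measurable_fun [set: g_sigma_algebraType (cylinder J)]
    (U : g_sigma_algebraType (cylinder J) -> R).

Lemma adapted_component J i : i \in J -> adapted J (X i).
Proof.
move=> iJ _ A mA; rewrite setTI; apply: sub_gen_smallest.
exists (fun j => if j == i then A else setT); split=> [j|].
  by case: ifP.
apply/seteqP; split=> [w Aw j/= jJ|w /(_ i iJ)]/=; last by rewrite eqxx.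
by case: eqP => // ->.
Qed.

Lemma adapted_measurable J U : adapted J U -> measurable_fun [set: T] U.
Proof.
move=> aU _ A mA; have := aU measurableT A mA.
have := @smallest_sub _ _ _ measurable (sigma_algebra_measurable T)
  (@cylinder_measurable J).
exact.
Qed.

Lemma adapted_indep J K U V : [disjoint J & K]%fset ->
  adapted J U -> adapted K V -> indep U V.
Proof.
move=> JK aU aV A B mA mB.
apply: (indep_g_sigma (@cylinder_setI J) (@cylinder_setI K)
  (@cylinder_measurable J) (@cylinder_measurable K)).
- by move=> S S'; exact: cylinder_indep.
- by have := aU measurableT A mA; rewrite setTI.
- by have := aV measurableT B mB; rewrite setTI.
Qed.

End blocks.
End independence.

(** * Lindeberg's swapping argument *)

Section lindeberg.
Context (d : measure_display) (T : measurableType d) (R : realType)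
  (Q : probability T R).
Local Notation L1 f := (Q.-integrable [set: T] (EFin \o f)).

Lemma indep_comp (U V : T -> R) (g h : R -> R) :
  measurable_fun [set: R] g -> measurable_fun [set: R] h ->
  indep Q U V -> indep Q (g \o U) (h \o V).
Proof.
move=> mg mh UV A B mA mB; apply: (UV (g @^-1` A) (h @^-1` B)).
  by rewrite -[X in measurable X]setTI; exact: mg.
by rewrite -[X in measurable X]setTI; exact: mh.
Qed.

Lemma L1_cst (k : R) : L1 (fun=> k).
Proof. exact: finite_measure_integrable_cst. Qed.

Lemma Rint_cst (k : R) : \int[Q]_w k = k.
Proof. by rewrite Rintegral_cst// [X in fine X]probability_setT mulr1. Qed.

Lemma L1_bounded (K : R) (f : T -> R) : measurable_fun [set: T] f ->
  (forall w, `|f w| <= K) -> L1 f.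
Proof. by move=> mf fK; exact: L1_le mf (L1_cst K) fK. Qed.

(* The Taylor terms of order at most 2 agree for [Y] and for a centered normal
   variable of variance [s ^+ 2]; only the two remainders survive. *)
Lemma lindeberg_step (q K s b : R) (f0 f1 f2 : R -> R) (U Y : T -> R) :
  taylor2 q K f0 f1 f2 -> 0 < s -> 0 <= q ->
  measurable_fun [set: T] U -> measurable_fun [set: T] Y ->
  L1 Y -> L1 (fun w => Y w ^+ 2) -> L1 (fun w => `|Y w| `^ q) ->
  \int[Q]_w Y w = 0 -> \int[Q]_w (Y w ^+ 2) = s ^+ 2 ->
  \int[Q]_w (`|Y w| `^ q) <= b -> indep Q U Y ->
  `|\int[Q]_w f0 (U w + Y w) - \int[Q]_w normal_smooth s f0 (U w)| <=
    K * (b + 2 * expR (q ^+ 2 / 2) * s `^ q).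
Proof.
move=> ft s0 q0 mU mY IY IY2 IYq EY EY2 EYq UY.
have [B0 B1 B2 t] := ft.
have K0 := bounded_lipschitz_ge0 B0.
have m0 := bounded_lipschitz_measurable B0.
have m1 := bounded_lipschitz_measurable B1.
have m2 := bounded_lipschitz_measurable B2.
have BG := bounded_lipschitz_smooth s B0.
have mG := bounded_lipschitz_measurable BG.
have mf1U : measurable_fun [set: T] (f1 \o U) by exact: measurableT_comp.
have mf2U : measurable_fun [set: T] (f2 \o U) by exact: measurableT_comp.
have mY2 : measurable_fun [set: T] (fun w => Y w ^+ 2).
  exact: measurable_funX.
have I0 : L1 (f0 \o U).
  apply: (@L1_bounded K) => [|w]; last exact: B0.1.
  exact: measurableT_comp.
have I1 : L1 (f1 \o U) by apply: (@L1_bounded K) => // w; exact: B1.1.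
have I2 : L1 (f2 \o U) by apply: (@L1_bounded K) => // w; exact: B2.1.
have IG : L1 (fun w => normal_smooth s f0 (U w)).
  apply: (@L1_bounded K) => [|w]; last exact: BG.1.
  exact: measurableT_comp.
have IUY : L1 (fun w => f0 (U w + Y w)).
  apply: (@L1_bounded K) => [|w]; last exact: B0.1.
  by apply: measurableT_comp => //; exact: measurable_funD.
have ind1 : indep Q (f1 \o U) Y by exact: (@indep_comp _ _ f1 id).
have ind2 : indep Q (f2 \o U) (fun w => Y w ^+ 2).
  by apply: (@indep_comp _ _ f2 (fun y => y ^+ 2)).
have J1 := L1_indepM mf1U mY ind1 I1 IY.
have J2 := L1_indepM mf2U mY2 ind2 I2 IY2.
have E1 := Rint_indepM mf1U mY ind1 I1 IY.
have E2 := Rint_indepM mf2U mY2 ind2 I2 IY2.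
rewrite EY mulr0 in E1; rewrite EY2 in E2.
rewrite mulrDr.
rewrite (_ : _ - _ =
  \int[Q]_w (f0 (U w + Y w) - f0 (U w) - f1 (U w) * Y w -
     2^-1 * (f2 (U w) * Y w ^+ 2)) -
  \int[Q]_w (normal_smooth s f0 (U w) - f0 (U w) -
     s ^+ 2 / 2 * f2 (U w))); last first.
  rewrite !RintegralB//.
  - rewrite !RintegralZl// E1 E2; first by rewrite /comp; field.
  - exact: L1B.
  - exact: L1Zl.
  - exact: L1B.
  - by apply: L1B => //; exact: L1B.
  - exact: L1Zl.
apply: le_trans (ler_normB _ _) _; apply: lerD.
  apply: (@le_trans _ _ (\int[Q]_w (K * `|Y w| `^ q))); last first.
    by rewrite RintegralZl// ler_wpM2l.
  apply: Rint_normr_le.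
  - apply: L1B; last exact: L1Zl.
    by apply: L1B => //; exact: L1B.
  - exact: L1Zl.
  - move=> w; apply: le_trans (t (U w) (Y w)).
    by rewrite le_eqVlt; apply/orP; left; apply/eqP; congr `|_|; field.
rewrite -[leRHS]Rint_cst; apply: Rint_normr_le.
- by apply: L1B; [exact: L1B|exact: L1Zl].
- exact: L1_cst.
- by move=> w; exact: normal_smooth_approx ft.
Qed.

(** Induction on [n]: swapping the last summand changes [f0] into [normal_smooth s f0], which
    satisfies [taylor2] with the same [q] and [K], so every swap costs the same. The test functions
    are quantified after [K] in order to vary along the induction. *)
Lemma lindeberg (q s b : R) (Y : nat -> T -> R) n :
  0 < s -> 0 <= q -> (forall i, measurable_fun [set: T] (Y i)) ->
  (forall i, L1 (Y i)) -> (forall i, L1 (fun w => Y i w ^+ 2)) ->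
  (forall i, L1 (fun w => `|Y i w| `^ q)) ->
  (forall i, \int[Q]_w Y i w = 0) ->
  (forall i, \int[Q]_w (Y i w ^+ 2) = s ^+ 2) ->
  (forall i, \int[Q]_w (`|Y i w| `^ q) <= b) ->
  (forall i, indep Q (fun w => \sum_(k < i) Y k w) (Y i)) ->
  forall K f0 f1 f2, taylor2 q K f0 f1 f2 ->
  `|\int[Q]_w f0 (\sum_(k < n) Y k w) - iter n (normal_smooth s) f0 0| <=
    n%:R * (K * (b + 2 * expR (q ^+ 2 / 2) * s `^ q)).
Proof.
move=> s0 q0 mY IY IY2 IYq EY EY2 EYq ind K.
have mS k : measurable_fun [set: T] (fun w => \sum_(i < k) Y i w).
  exact: measurable_sum.
elim: n => [|n IH] f0 f1 f2 ft.
  under eq_Rintegral do rewrite big_ord0.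
  by rewrite Rint_cst subrr normr0 mul0r.
under eq_Rintegral do rewrite big_ord_recr/=.
have := lindeberg_step ft s0 q0 (mS n) (mY n) (IY n) (IY2 n) (IYq n)
  (EY n) (EY2 n) (EYq n) (ind n).
have := IH _ _ _ (taylor2_smooth s ft).
rewrite -iterSr -[n.+1%:R]natr1 (mulrDl n%:R) mul1r.
set a := \int[Q]_w _; set c := \int[Q]_w _; set e := iter _ _ _ _.
move=> h1 h2; rewrite (_ : c - e = (a - e) + (c - a)); last by ring.
by apply: le_trans (ler_normD _ _) _; exact: lerD h1 h2.
Qed.

End lindeberg.

(** * Logistic test functions *)

Section test_functions.
Context {R : realType}.
Implicit Types (f g : R -> R) (x y h : R).

Lemma MVT_between f df a b : (forall x, is_derive x 1 f (df x)) ->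
  exists2 c, `|c - a| <= `|b - a| & f b - f a = df c * (b - a).
Proof.
move=> fdf.
have cf : continuous f.
  move=> x; apply: differentiable_continuous; apply/derivable1_diffP.
  exact: (@ex_derive _ _ _ _ _ _ _ (fdf x)).
have [ab|ba] := leP a b.
  have [|c cab ->] := MVT_segment ab (fun x _ => fdf x).
    exact: continuous_subspaceT.
  exists c => //; move: cab; rewrite in_itv/= => /andP[ac cb].
  by rewrite !ger0_norm ?subr_ge0// lerD2r.
have [|c cab e] := MVT_segment (ltW ba) (fun x _ => fdf x).
  exact: continuous_subspaceT.
exists c; last by rewrite -opprB e -mulrN opprB.
move: cab; rewrite in_itv/= => /andP[ac cb].
by rewrite !ler0_norm ?subr_le0 ?(ltW ba)// lerN2 lerD2r.
Qed.

Lemma bounded_derive_lipschitz K f df : (forall x, is_derive x 1 f (df x)) ->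
  (forall x, `|df x| <= K) -> forall x y, `|f x - f y| <= K * `|x - y|.
Proof.
move=> fdf dK x y; have [c _ ->] := MVT_between y x fdf.
by rewrite normrM ler_wpM2r.
Qed.

Lemma min_cube_square_powR q h : 2 <= q <= 3 ->
  Num.min (`|h| ^+ 3) (`|h| ^+ 2) <= `|h| `^ q.
Proof.
move=> /andP[q2 q3]; rewrite -!powR_mulrn//.
have [->|h0] := eqVneq h 0.
  by rewrite normr0 !powR0 ?minxx//; lra.
have [h1|h1] := leP `|h| 1.
  by rewrite ge_min ger_powR//; rewrite normr_gt0 h0.
by rewrite ge_min orbC ler_powR// ltW.
Qed.

(** Two applications of the mean value theorem write the remainder as [(f2(x + e) - f2(x)) c h] with
    [|e| <= |c| <= |h|]. The difference is at most [2K] and at most [K |h|], which gives the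
    quadratic and the cubic bound to be interpolated by [min_cube_square_powR]. *)
Lemma taylor2_C3 q K f0 f1 f2 f3 : 2 <= q <= 3 ->
  (forall x, is_derive x 1 f0 (f1 x)) ->
  (forall x, is_derive x 1 f1 (f2 x)) ->
  (forall x, is_derive x 1 f2 (f3 x)) ->
  (forall x, [/\ `|f0 x| <= K, `|f1 x| <= K, `|f2 x| <= K & `|f3 x| <= K]) ->
  taylor2 q (2 * K) f0 f1 f2.
Proof.
move=> q23 d0 d1 d2 fK.
have K0 : 0 <= K by have [h _ _ _] := fK 0; exact: le_trans h.
have KK : K <= 2 * K by lra.
have b0 x : `|f0 x| <= K by have [] := fK x.
have b1 x : `|f1 x| <= K by have [] := fK x.
have b2 x : `|f2 x| <= K by have [] := fK x.
have b3 x : `|f3 x| <= K by have [] := fK x.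
have L (f df : R -> R) : (forall x, is_derive x 1 f (df x)) ->
    (forall x, `|f x| <= K) -> (forall x, `|df x| <= K) ->
    bounded_lipschitz (2 * K) f.
  move=> fdf bf bdf; split=> [x|]; first exact: le_trans (bf x) KK.
  by apply: bounded_derive_lipschitz fdf _ => x; exact: le_trans (bdf x) KK.
split; [exact: L d0 b0 b1|exact: L d1 b1 b2|exact: L d2 b2 b3|move=> x h].
have ds (f df : R -> R) : (forall x, is_derive x 1 f (df x)) ->
    forall t, is_derive t (1 : R) (fun t => f (x + t)) (df (x + t)).
  move=> fdf t; have d : is_derive t (1 : R) (fun t : R => x + t) 1.
    by apply: is_derive_eq; rewrite add0r mulr1.
  have := @is_derive1_comp _ f (fun t => x + t) t _ _ (fdf _) d.
  by rewrite mulr1.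
pose F t := f0 (x + t) - t * f1 x - t ^+ 2 / 2 * f2 x.
have dF t : is_derive t (1 : R) F (f1 (x + t) - f1 x - t * f2 x).
  have := ds _ _ d0 t => d0t.
  by apply: is_derive_eq; rewrite /GRing.scale/=; field.
pose G t := f1 (x + t) - t * f2 x.
have dG t : is_derive t (1 : R) G (f2 (x + t) - f2 x).
  have := ds _ _ d1 t => d1t.
  by apply: is_derive_eq; rewrite /GRing.scale/=; ring.
have [c ch eF] := MVT_between 0 h dF.
have [e ec eG] := MVT_between 0 c dG.
rewrite !subr0 in ch ec eF eG.
have -> : f0 (x + h) - f0 x - h * f1 x - h ^+ 2 / 2 * f2 x =
    (f2 (x + e) - f2 x) * c * h.
  rewrite -eG /G mul0r addr0 subr0; move: eF; rewrite /F expr0n/= !mul0r addr0.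
  move=> eF; transitivity (f0 (x + h) - h * f1 x - h ^+ 2 / 2 * f2 x - (f0 x - 0 - 0)).
    by ring.
  by rewrite eF; ring.
have A : `|f2 (x + e) - f2 x| <= 2 * K.
  by rewrite (le_trans (ler_normB _ _))//; have := b2 (x + e); have := b2 x; lra.
have B : `|f2 (x + e) - f2 x| <= K * `|h|.
  have := bounded_derive_lipschitz d2 b3 (x + e) x.
  rewrite addrAC subrr add0r => /le_trans; apply.
  by rewrite ler_wpM2l// (le_trans ec).
rewrite !normrM.
apply: (@le_trans _ _ (2 * K * Num.min (`|h| ^+ 3) (`|h| ^+ 2))); last first.
  by rewrite ler_wpM2l ?min_cube_square_powR// mulr_ge0.
rewrite minr_pMr ?mulr_ge0// le_min; apply/andP; split.
  rewrite (le_trans (ler_pM _ _ (ler_pM _ _ B ch) (lexx `|h|)))//.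
  rewrite (_ : K * _ * _ * _ = K * `|h| ^+ 3); last by ring.
  by rewrite ler_wpM2r// exprn_ge0.
rewrite (le_trans (ler_pM _ _ (ler_pM _ _ A ch) (lexx `|h|)))//.
by rewrite -mulrA -expr2.
Qed.

(** With this sign the function decreases when [k > 0], so it imitates the indicator of the
    half-line up to [a], whose expectation is a distribution function. *)
Definition logistic k a y := (1 + expR (k * (y - a)))^-1.

Lemma logistic_ge0 k a y : 0 <= logistic k a y.
Proof. by rewrite invr_ge0 addr_ge0// expR_ge0. Qed.

Lemma logistic_le1 k a y : logistic k a y <= 1.
Proof.
by rewrite invf_le1 ?lerDl ?expR_ge0// ltr_wpDr// expR_ge0.
Qed.

Lemma is_derive_logistic k a y : is_derive y 1 (logistic k a)
  (k * (logistic k a y ^+ 2 - logistic k a y)).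
Proof.
have e0 : 1 + expR (k * (y - a)) != 0.
  by rewrite lt0r_neq0// ltr_wpDr// expR_ge0.
have d1 : is_derive y (1 : R) (fun y => k * (y - a)) k.
  by apply: is_derive_eq; rewrite /GRing.scale/=; ring.
have d2 := @is_derive1_comp _ expR (fun y => k * (y - a)) y _ _
  (is_derive_expR _) d1.
have d3 : is_derive y (1 : R) (fun y => 1 + expR (k * (y - a)))
    (expR (k * (y - a)) * k).
  apply: (is_derive_eq (is_deriveD (is_derive_cst (1 : R) y 1) d2)).
  by rewrite add0r.
have := @is_deriveV _ (fun y => 1 + expR (k * (y - a))) y _ _ e0 d3.
move=> d4; apply: (is_derive_eq d4); rewrite /logistic /GRing.scale/=.
by field.
Qed.

Lemma logistic_taylor2 q k a : 2 <= q <= 3 -> exists K f1 f2,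
  taylor2 q K (logistic k a) f1 f2.
Proof.
move=> q23; pose L := logistic k a.
pose f1 y := k * (L y ^+ 2 - L y).
pose f2 y := k * (2 * L y - 1) * f1 y.
(* Differentiating [f2] gives [2 k f1^2 + k^2 (2L - 1)^2 f1]; one factor [f1] is replaced by
   [k (L^2 - L)]. *)
pose f3 y := k ^+ 2 * (6 * L y ^+ 2 - 6 * L y + 1) * f1 y.
(* One summand per function from [L] to [f3]; [13 = 6 + 6 + 1] bounds the quadratic factor of [f3],
   as [L] lies between 0 and 1. *)
pose K := 1 + `|k| + `|k| ^+ 2 + 13 * `|k| ^+ 3.
have dL y : is_derive y 1 L (f1 y) by exact: is_derive_logistic.
have d1 y : is_derive y 1 f1 (f2 y).
  have := dL y => dLy.
  by rewrite /f1; apply: is_derive_eq; rewrite /GRing.scale/= /f2; ring.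
have d2 y : is_derive y 1 f2 (f3 y).
  have := dL y => dLy; have := d1 y => d1y.
  rewrite /f2; apply: is_derive_eq; rewrite /GRing.scale/= /f3 /f2.
  by rewrite {2}/f1; ring.
have L0 y : 0 <= L y := logistic_ge0 k a y.
have L1 y : L y <= 1 := logistic_le1 k a y.
have k0 : 0 <= `|k| by [].
have k2 : 0 <= `|k| ^+ 2 by exact: exprn_ge0.
have k3 : 0 <= `|k| ^+ 3 by exact: exprn_ge0.
have bf1 y : `|f1 y| <= `|k|.
  rewrite normrM ler_piMr// ler_norml; have := L0 y; have := L1 y.
  by move=> ? ?; apply/andP; nra.
exists (2 * K), f1, f2; apply: (taylor2_C3 q23 dL d1 d2) => y; split.
- by rewrite ger0_norm ?L0// (le_trans (L1 y))// /K; lra.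
- by rewrite (le_trans (bf1 y))// /K; lra.
- rewrite normrM normrM; apply: (@le_trans _ _ (`|k| * 1 * `|k|)).
    apply: ler_pM => //; apply: ler_wpM2l => //.
    by rewrite ler_norml; have := L0 y; have := L1 y; lra.
  by rewrite mulr1 -expr2 /K; lra.
- rewrite normrM normrM normrX; apply: (@le_trans _ _ (`|k| ^+ 2 * 13 * `|k|)).
    apply: ler_pM => //; apply: ler_wpM2l => //.
    rewrite ler_norml; have := L0 y; have := L1 y.
    by move=> ? ?; apply/andP; nra.
  rewrite mulrAC -exprSr /K; lra.
Qed.

Lemma logistic_step x e delta : 0 < e -> 0 < delta -> exists k a,
  (forall y, y <= x -> 1 - e <= logistic k a y) /\
  (forall y, x + delta <= y -> logistic k a y <= e).
Proof.
(* Centered at the midpoint of the transition zone, with slope such that [k * delta / 2 = 1 / e]. At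
   both ends [exp(1 / e) >= 1 / e] then suffices. *)
move=> e0 d0; pose k := 2 / (delta * e); pose a := x + delta / 2.
have k0 : 0 < k by rewrite divr_gt0// mulr_gt0.
have kd : k * (delta / 2) = e^-1.
  by rewrite /k; field; rewrite !lt0r_neq0.
have ee : e^-1 <= expR e^-1.
  by have := @expR_ge1Dx R e^-1; lra.
exists k, a; split=> y yx.
  have h : expR (k * (y - a)) <= e.
    apply: (@le_trans _ _ (expR (- e^-1))).
      rewrite ler_expR -kd -mulrN ler_pM2l// /a; lra.
    by rewrite expRN -[leRHS]invrK lef_pV2// posrE ?invr_gt0 ?expR_gt0.
  have h0 := expR_gt0 (k * (y - a)).
  rewrite /logistic; apply: (@le_trans _ _ (1 + e)^-1).
    by rewrite -[leRHS]mul1r ler_pdivlMr; [nra|lra].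
  by rewrite lef_pV2 ?posrE; lra.
have h : e^-1 <= expR (k * (y - a)).
  apply: (le_trans ee); rewrite ler_expR -kd ler_pM2l// /a; lra.
have h0 := expR_gt0 (k * (y - a)).
rewrite -[leRHS]invrK lef_pV2 ?posrE ?invr_gt0//; lra.
Qed.

End test_functions.

(** * From logistic test functions to distribution functions *)

Section weak_limit.
Context (d : measure_display) (T : measurableType d) (R : realType)
  (Q : probability T R).
Local Notation mu := (@lebesgue_measure R).
Local Notation gauss := (normal_prob (0 : R) 1).
Implicit Types (e x : R) (f : R -> R).

Lemma measurable_logistic (k a : R) : measurable_fun [set: R] (logistic k a).
Proof.
apply: continuous_measurable_fun => y; apply: differentiable_continuous.
apply/derivable1_diffP.
exact: (@ex_derive _ _ _ _ _ _ _ (is_derive_logistic k a y)).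
Qed.

Lemma indicleE (y x : R) : \1_`]-oo, x]%classic y = if y <= x then 1 else 0 :> R.
Proof.
by rewrite indicE (_ : (y \in _) = (y <= x)); [case: ifP|apply/idP/idP;
  rewrite inE/= in_itv].
Qed.

Lemma L1_indic_normal x : mu.-integrable [set: R]
  (EFin \o (fun y => \1_`]-oo, x] y * normal_pdf 0 1 y)).
Proof.
apply: (@L1_bounded_normal _ 1); first exact: measurable_indic.
by move=> y; rewrite indicleE; case: ifP; rewrite ?normr1 ?normr0.
Qed.

Lemma Rint_indic_normal x :
  \int[mu]_y (\1_`]-oo, x] y * normal_pdf 0 1 y) = fine (gauss `]-oo, x]%classic).
Proof.
rewrite /normal_prob -/(Rintegral _ _ _) [RHS]Rintegral_mkcond.
by apply: Rint_eq => y; rewrite /= patchE indicE; case: ifP; rewrite ?mul1r ?mul0r.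
Qed.

Lemma Rint_indic_RV (S : {RV Q >-> R}) x :
  Q.-integrable [set: T] (EFin \o (fun w => \1_`]-oo, x] (S w))) /\
  \int[Q]_w (\1_`]-oo, x] (S w)) = fine (cdf S x).
Proof.
have mA : measurable (S @^-1` `]-oo, x]).
  by rewrite -[X in measurable X]setTI; exact: measurable_funP.
rewrite (_ : (fun w => _) = \1_(S @^-1` `]-oo, x])); last exact/funext.
split; first exact: integrable_indic.
by rewrite /Rintegral integral_indic// setIT.
Qed.

Section sandwich.
Variables (f : R -> R) (e x : R).
Hypotheses (mf : measurable_fun [set: R] f) (f01 : forall y, 0 <= f y <= 1).
Hypothesis e0 : 0 < e.

Let f1 y : `|f y| <= 1.
Proof. by have /andP[? ?] := f01 y; rewrite ger0_norm. Qed.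

(** Up to the error [e], [f] lies below the indicator of the half-line. The Gaussian and the random
    variable are treated together, since a comparison uses one side for each. *)
Lemma sandwich_ge : (forall y, x <= y -> f y <= e) ->
  \int[mu]_y (f y * normal_pdf 0 1 y) <= fine (gauss `]-oo, x]%classic) + e /\
  forall S : {RV Q >-> R}, \int[Q]_w f (S w) <= fine (cdf S x) + e.
Proof.
move=> fe.
have le y : f y <= \1_`]-oo, x] y + e.
  rewrite indicleE; case: ifPn => [_|]; last first.
    by rewrite -ltNge add0r => /ltW; exact: fe.
  by have /andP[_ h] := f01 y; apply: le_trans h _; rewrite lerDl ltW.
split=> [|S].
  apply: (@le_trans _ _ (\int[mu]_y (\1_`]-oo, x] y * normal_pdf 0 1 y +
      e * normal_pdf 0 1 y))).
    apply: Rint_le.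
    - exact: L1_bounded_normal mf f1.
    - apply: L1D; first exact: L1_indic_normal.
      by apply: L1Zl; exact: L1_normal_pdf.
    - by move=> y; rewrite -mulrDl ler_wpM2r// normal_pdf_ge0.
  rewrite RintegralD//; last 2 first.
  - exact: L1_indic_normal.
  - by apply: L1Zl; exact: L1_normal_pdf.
  rewrite RintegralZl//; last exact: L1_normal_pdf.
  by rewrite Rint_normal_pdf mulr1 Rint_indic_normal.
have [IS <-] := Rint_indic_RV S x.
rewrite -[X in _ + X](Rint_cst Q) -RintegralD//; last exact: L1_cst.
apply: Rint_le => //.
- by apply: (@L1_bounded _ _ _ _ 1) => //; exact: measurableT_comp.
- by apply: L1D => //; exact: L1_cst.
Qed.

Lemma sandwich_le : (forall y, y <= x -> 1 - e <= f y) ->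
  fine (gauss `]-oo, x]%classic) - e <= \int[mu]_y (f y * normal_pdf 0 1 y) /\
  forall S : {RV Q >-> R}, fine (cdf S x) - e <= \int[Q]_w f (S w).
Proof.
move=> fe.
have le y : \1_`]-oo, x] y - e <= f y.
  rewrite indicleE; case: ifP => [/fe//|_].
  by have /andP[h _] := f01 y; rewrite sub0r (le_trans _ h)// oppr_le0 ltW.
split=> [|S].
  apply: (@le_trans _ _ (\int[mu]_y (\1_`]-oo, x] y * normal_pdf 0 1 y -
      e * normal_pdf 0 1 y))).
    rewrite RintegralB//; last 2 first.
    - exact: L1_indic_normal.
    - by apply: L1Zl; exact: L1_normal_pdf.
    rewrite RintegralZl//; last exact: L1_normal_pdf.
    by rewrite Rint_normal_pdf mulr1 Rint_indic_normal.
  apply: Rint_le.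
  - apply: L1B; first exact: L1_indic_normal.
    by apply: L1Zl; exact: L1_normal_pdf.
  - exact: L1_bounded_normal mf f1.
  - by move=> y; rewrite -mulrBl ler_wpM2r// normal_pdf_ge0.
have [IS <-] := Rint_indic_RV S x.
rewrite -[X in _ - X](Rint_cst Q) -RintegralB//; last exact: L1_cst.
apply: Rint_le => //.
- by apply: L1B => //; exact: L1_cst.
- by apply: (@L1_bounded _ _ _ _ 1) => //; exact: measurableT_comp.
Qed.

End sandwich.

Lemma cvg_in_distribution_logistic (S : nat -> {RV Q >-> R}) :
  (forall k a, \int[Q]_w logistic k a (S n w) @[n --> \oo] -->
     \int[mu]_y (logistic k a y * normal_pdf 0 1 y)) ->
  cvg_in_distribution Q S gauss.
Proof.
move=> cvgS x cx.
have fing y : gauss `]-oo, y]%classic \is a fin_num by exact: fin_num_measure.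
have finS n y : cdf (S n) y \is a fin_num by exact: fin_num_measure.
suff : cdf (S n) x @[n --> \oo] --> (fine (gauss `]-oo, x]%classic))%:E.
  by rewrite fineK.
apply/fine_cvgP; split; first exact: nearW.
apply/cvgrPdist_le => e e0.
(* Four errors add up: continuity of the limit at [x], the sandwich for the normal law, the sandwich
   for [S n], and convergence for the test function. *)
have e4 : 0 < e / 4 by rewrite divr_gt0.
have [dl dl0 [hu hl]] : exists2 dl, 0 < dl &
    fine (gauss `]-oo, (x + dl)]%classic) <= fine (gauss `]-oo, x]%classic) + e / 4 /\
    fine (gauss `]-oo, x]%classic) - e / 4 <= fine (gauss `]-oo, (x - dl)]%classic).
  have : gauss `]-oo, r]%classic @[r --> x] -->
    (fine (gauss `]-oo, x]%classic))%:E by rewrite fineK//; exact: cx.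
  move=> /fine_cvgP[_].
  move=> /cvgrPdist_le/(_ _ e4)[r /= r0 hr].
  exists (r / 2); first by rewrite divr_gt0.
  have h1 := hr (x + r / 2); have h2 := hr (x - r / 2).
  rewrite /ball_/= opprD addNKr normrN gtr0_norm ?divr_gt0// in h1.
  rewrite /ball_/= opprB addrC subrK gtr0_norm ?divr_gt0// in h2.
  have rr : r / 2 < r by lra.
  move: (h1 rr) (h2 rr); rewrite !ler_norml => /andP[? ?] /andP[? ?]; lra.
have l01 (k a y : R) : 0 <= logistic k a y <= 1.
  by rewrite logistic_ge0 logistic_le1.
(* This function falls between [x] and [x + dl] and bounds the distribution function of [S n] from
   above; the next one falls between [x - dl] and [x] and bounds it from below. *)
have [k1 [a1 [p1 q1]]] := logistic_step x e4 dl0.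
have [k2 [a2 [p2 q2]]] := logistic_step (x - dl) e4 dl0.
have [_ A1] := sandwich_le (measurable_logistic k1 a1) (l01 k1 a1) e4 p1.
have [B1 _] := sandwich_ge (measurable_logistic k1 a1) (l01 k1 a1) e4 q1.
have [A2 _] := sandwich_le (measurable_logistic k2 a2) (l01 k2 a2) e4 p2.
rewrite subrK in q2.
have [_ B2] := sandwich_ge (measurable_logistic k2 a2) (l01 k2 a2) e4 q2.
have /cvgrPdist_le/(_ _ e4) C1 := cvgS k1 a1.
have /cvgrPdist_le/(_ _ e4) C2 := cvgS k2 a2.
near=> n.
have : `|\int[mu]_y (logistic k1 a1 y * normal_pdf 0 1 y) -
         \int[Q]_w logistic k1 a1 (S n w)| <= e / 4 by near: n.
have : `|\int[mu]_y (logistic k2 a2 y * normal_pdf 0 1 y) -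
         \int[Q]_w logistic k2 a2 (S n w)| <= e / 4 by near: n.
have := A1 (S n); have := B2 (S n); move: B1 A2 hu hl.
rewrite !ler_norml => ? ? ? ? ? ? /andP[? ?] /andP[? ?].
by apply/andP; split; rewrite /=; lra.
Unshelve. all: end_near. Qed.

End weak_limit.

(** * Moment generating functions *)

(** The normalization [n * s^2 = 1] makes the [n] smoothings a single one of variance 1, evaluated
    at [0]; it also rules out [n = 0]. *)
Lemma lindeberg_normal (d : measure_display) (T : measurableType d)
    (R : realType) (Q : probability T R) (q s b : R) (Y : nat -> T -> R) n :
  0 < s -> 0 <= q -> n%:R * s ^+ 2 = 1 ->
  (forall i, measurable_fun [set: T] (Y i)) ->
  (forall i, Q.-integrable [set: T] (EFin \o Y i)) ->
  (forall i, Q.-integrable [set: T] (EFin \o (fun w => Y i w ^+ 2))) ->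
  (forall i, Q.-integrable [set: T] (EFin \o (fun w => `|Y i w| `^ q))) ->
  (forall i, \int[Q]_w Y i w = 0) ->
  (forall i, \int[Q]_w (Y i w ^+ 2) = s ^+ 2) ->
  (forall i, \int[Q]_w (`|Y i w| `^ q) <= b) ->
  (forall i, indep Q (fun w => \sum_(k < i) Y k w) (Y i)) ->
  forall K f0 f1 f2, taylor2 q K f0 f1 f2 ->
  `|\int[lebesgue_measure]_y (f0 y * normal_pdf 0 1 y) -
    \int[Q]_w f0 (\sum_(k < n) Y k w)| <=
    n%:R * (K * (b + 2 * expR (q ^+ 2 / 2) * s `^ q)).
Proof.
move=> s0 q0 ns mY IY IY2 IYq EY EY2 EYq ind K f0 f1 f2 ft.
have := lindeberg n s0 q0 mY IY IY2 IYq EY EY2 EYq ind ft.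
case: n ns => [|n ns]; first by rewrite mul0r => /esym/eqP; rewrite oner_eq0.
have [B0 _ _ _] := ft; rewrite (normal_smooth_iter _ _ s0 B0) distrC.
rewrite (_ : Num.sqrt _ * s = 1).
  by rewrite /normal_smooth; under eq_Rintegral do rewrite add0r.
by rewrite -[X in _ * X](gtr0_norm s0) -sqrtr_sqr -sqrtrM// ns sqrtr1.
Qed.

Lemma derive1_lt_increment (R : realType) (f : R -> R) (x l : R) :
  derivable f x 1 -> derive1 f x < l ->
  exists2 h, 0 < h <= 1 & f (x + h) - f x < h * l.
Proof.
move=> df dl.
have : h^-1 *: (f (h + x) - f x) @[h --> 0^'] --> derive1 f x.
  rewrite (_ : (fun h => _) =
    (fun h : R => h^-1 *: ((f \o shift x) (h *: 1) - f x))).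
    by rewrite derive1E; exact: df.
  by apply/funext => h; rewrite /= [h *: 1]mulr1.
move=> /cvgrPdist_lt.
have e0 : 0 < l - derive1 f x by rewrite subr_gt0.
move=> /(_ _ e0)[r /= r0 hr].
pose h := Num.min 1 (r / 2).
have h0 : 0 < h by rewrite lt_min ltr01 divr_gt0.
have h1 : h <= 1 by rewrite ge_min lexx.
have hr2 : h <= r / 2 by rewrite ge_min lexx orbT.
have hltr : h < r by lra.
exists h; first by rewrite h0.
have := hr h; rewrite /= sub0r normrN gtr0_norm// => /(_ hltr (lt0r_neq0 h0)).
rewrite ltr_norml => /andP[H _]; rewrite -ltr_pdivrMl// (addrC x).
by move: H; rewrite /GRing.scale/=; lra.
Qed.

Lemma derive1_lt_exponent (R : realType) (f : R -> R) (c : R) :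
  derivable f 2 1 -> 2 * derive1 f 2 - f 2 < c ->
  exists2 q, 2 < q <= 3 & f q - q / 2 * f 2 < c * (q / 2 - 1).
Proof.
move=> df Dc.
(* For [q = 2 + h] the goal says that [f(2 + h) - f(2)] is less than [h (c + f(2)) / 2], so this is
   the slope to beat. The bound [h <= 1] supplied by the increment lemma gives [q <= 3]. *)
have dl : derive1 f 2 < (c + f 2) / 2 by lra.
have [h /andP[h0 h1] H] := derive1_lt_increment df dl.
exists (2 + h); first by apply/andP; split; lra.
have -> : c * ((2 + h) / 2 - 1) = h * c / 2 by field.
have -> : (2 + h) / 2 * f 2 = f 2 + h * f 2 / 2 by field.
have e3 : h * ((c + f 2) / 2) = h * c / 2 + h * f 2 / 2 by field.
by rewrite e3 in H; lra.
Qed.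

Section moment_generating_function.
Context (d : measure_display) (T : measurableType d) (R : realType)
  (P : probability T R) (X : {RV P >-> R}).
Local Notation L1 f := (P.-integrable [set: T] (EFin \o f)).

Definition mgf (t : R) := \int[P]_w expR (t * X w).

Lemma measurable_expRM (t : R) : measurable_fun [set: T] (fun w => expR (t * X w)).
Proof. by apply: measurableT_comp => //; exact: measurable_funM. Qed.

Lemma mmt_gen_funE (t : R) : mmt_gen_fun P X t = (\int[P]_w (expR (t * X w))%:E)%E.
Proof.
rewrite /mmt_gen_fun unlock; apply: eq_integral => w _ /=.
by rewrite mulrC.
Qed.

(** Where the expectation is infinite, as may happen for negative [t], both sides take the default
    value [0]. The identity thus holds between functions, as rewriting under [derive1] requires. *)
Lemma fine_cumulant_gen_fun : fine \o cumulant_gen_fun P X = (fun t => ln (mgf t)).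
Proof.
apply/funext => t; rewrite /= /cumulant_gen_fun /mgf /Rintegral mmt_gen_funE.
case: (\int[P]_w _)%E => [r| |]/=; [|by rewrite ln0..].
by case: leP => // r0; rewrite ln0.
Qed.

Hypothesis fin_cumulant : forall t : R, 0 <= t -> cumulant_gen_fun P X t \is a fin_num.

Lemma mgf_EFin_gt0 (t : R) : 0 <= t ->
  (\int[P]_w (expR (t * X w))%:E < +oo)%E /\ 0 < mgf t.
Proof.
move=> /fin_cumulant; rewrite /cumulant_gen_fun mmt_gen_funE /mgf /Rintegral.
case: (\int[P]_w _)%E => [r| |]//=; case: ifPn => //.
by rewrite -ltNge => r0 _; split=> //; exact: ltry.
Qed.

Lemma mgf_gt0 (t : R) : 0 <= t -> 0 < mgf t.
Proof. by move=> /mgf_EFin_gt0[]. Qed.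

Lemma L1_expRM (t : R) : 0 <= t -> L1 (fun w => expR (t * X w)).
Proof.
move=> t0; apply/integrableP; split.
  by apply/measurable_EFinP; exact: measurable_expRM.
have [h _] := mgf_EFin_gt0 t0; apply: le_lt_trans h.
by under eq_integral do rewrite /= ger0_norm ?expR_ge0//.
Qed.

Lemma is_derive_mgf (t : R) : 0 < t ->
  is_derive t 1 mgf (\int[P]_w (X w * expR (t * X w))).
Proof.
move=> t0.
have m1 : measurable_fun [set: T] (fun=> 1 : R) by [].
have mX : measurable_fun [set: T] X by [].
have L1w (a : R) : 0 < a < t + 1 -> L1 (fun w => 1 * expR (a * X w)).
  move=> /andP[a0 _]; under eq_fun do rewrite /= mul1r.
  by apply: L1_expRM; exact: ltW.
have [|_ h] := exp_int_derive m1 mX L1w (t := t); first by rewrite t0 ltrDl ltr01.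
rewrite /mgf.
rewrite (_ : (fun a => _) = (fun a => \int[P]_w (1 * expR (a * X w)))).
  apply: is_derive_eq.
  by apply: Rint_eq => w; rewrite mul1r.
by apply/funext => a; apply: Rint_eq => w; rewrite mul1r.
Qed.

Lemma exists_lyapunov_exponent (c : R) :
  2 * derive1 (fine \o cumulant_gen_fun P X) 2 - fine (cumulant_gen_fun P X 2) < c ->
  exists2 q, 2 < q <= 3 &
    ln (mgf q) - q / 2 * ln (mgf 2) < c * (q / 2 - 1).
Proof.
rewrite -[fine (_ 2)]/((fine \o cumulant_gen_fun P X) 2) fine_cumulant_gen_fun.
apply: derive1_lt_exponent.
have t2 : 0 < 2 :> R by [].
have h2 := @is_derive1_comp _ (@ln R) mgf 2 _ _
  (is_derive1_ln (mgf_gt0 (ltW t2))) (is_derive_mgf t2).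
exact: (@ex_derive _ _ _ _ _ _ _ h2).
Qed.

(** The gap is the variance of [exp X]. If it vanished, [exp X] would be almost surely constant, and
    so would [X]. *)
Lemma mgf1_sqr_lt : non_degenerate X -> mgf 1 ^+ 2 < mgf 2.
Proof.
move=> nd; pose D w := expR (1 * X w) - mgf 1.
have I1 := L1_expRM ler01.
have I2 : L1 (fun w => expR (2 * X w)) by apply: L1_expRM.
have ED : \int[P]_w (D w ^+ 2) = mgf 2 - mgf 1 ^+ 2.
  transitivity (\int[P]_w (expR (2 * X w) - 2 * mgf 1 * expR (1 * X w) +
      mgf 1 ^+ 2)).
    apply: Rint_eq => w; rewrite /D (_ : 2 * X w = 1 * X w + 1 * X w); last by ring.
    by rewrite expRD; ring.
  rewrite RintegralD//; last 2 first.
  - by apply: L1B => //; exact: L1Zl.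
  - exact: L1_cst.
  rewrite RintegralB//; last exact: L1Zl.
  rewrite RintegralZl// Rint_cst -/(mgf 1) -/(mgf 2).
  by move: (mgf 1) (mgf 2) => x y; ring.
have D0 w : 0 <= D w ^+ 2 by exact: sqr_ge0.
rewrite -subr_gt0 -ED lt_neqAle Rintegral_ge0// andbT.
apply/eqP => /esym E0; apply: nd; exists (ln (mgf 1)).
have mD : measurable_fun [set: T] D.
  by apply: measurable_funB => //; exact: measurable_expRM.
have mD2 : measurable_fun [set: T] (EFin \o (fun w => D w ^+ 2)).
  by apply/measurable_EFinP; exact: measurable_funX.
have ID2 : L1 (fun w => D w ^+ 2).
  have : L1 (fun w => expR (2 * X w) - 2 * mgf 1 * expR (1 * X w) + mgf 1 ^+ 2).
    by apply: L1D; [apply: L1B => //; exact: L1Zl|exact: L1_cst].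
  apply: eq_integrable => // w _ /=.
  rewrite /D (_ : 2 * X w = 1 * X w + 1 * X w); last by ring.
  by rewrite expRD; congr EFin; ring.
have /(ae_eq_integral_abs _ measurableT mD2) : 
    (\int[P]_w `|(EFin \o (fun w => (D w ^+ 2)%R)) w|)%E = 0.
  rewrite (eq_integral (fun w => (D w ^+ 2)%R%:E)); last first.
    by move=> w _; rewrite gee0_abs// lee_fin.
  by rewrite -L1_EFin_int// E0.
apply: filterS => w /(_ I) [] /eqP; rewrite sqrf_eq0 subr_eq0 mul1r => /eqP <-.
by rewrite expRK.
Qed.

End moment_generating_function.

(** * Products of exponentials *)

Section random_array.
Context (R : realType) (d : measure_display) (T : measurableType d)
  (P : probability T R) (X : {RV P >-> R})
  (d' : measure_display) (T' : measurableType d') (Q : probability T' R)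
  (Xs : nat * nat -> {RV Q >-> R}).
Hypothesis fin_cumulant :
  forall t : R, 0 <= t -> cumulant_gen_fun P X t \is a fin_num.
Hypothesis copies : independent_copies X Xs.
Local Notation L1 f := (Q.-integrable [set: T'] (EFin \o f)).
Local Notation M := (mgf X).
Implicit Types (t q : R) (n i j : nat).

(** Equal laws give equal integrals of a nonnegative function, possibly infinite; integrability on
    the space of the array is then inherited from that of [X]. *)
Lemma copy_expRM t p : 0 <= t ->
  L1 (fun w => expR (t * Xs p w)) /\ \int[Q]_w expR (t * Xs p w) = M t.
Proof.
move=> t0; have mE : measurable_fun [set: R] (fun y => (expR (t * y))%:E).
  apply/measurable_EFinP; apply: (measurableT_comp (@measurable_expR R)).
  exact: measurable_mulr_cst.
have E0 y : (0 <= (expR (t * y))%:E)%E by rewrite lee_fin expR_ge0.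
have e : (\int[Q]_w (expR (t * Xs p w))%:E = \int[P]_w (expR (t * X w))%:E)%E.
  have /= <- := ge0_integral_distribution (Xs p) mE E0.
  have /= <- := ge0_integral_distribution X mE E0.
  by apply: eq_measure_integral => A mA _; exact: copies.2.
split; last by rewrite /M /mgf /Rintegral e.
apply/integrableP; split.
  by apply/measurable_EFinP; exact: measurable_expRM.
under eq_integral do rewrite /= ger0_norm ?expR_ge0//.
by rewrite e; have [] := mgf_EFin_gt0 fin_cumulant t0.
Qed.

Definition row i n : {fset nat * nat} := [fset p in [seq (i, j) | j <- iota 0 n]]%fset.
Definition rows i n : {fset nat * nat} :=
  [fset p in [seq (k, j) | k <- iota 0 i, j <- iota 0 n]]%fset.

Lemma mem_row i n k j : ((k, j) \in row i n) = (k == i) && (j < n)%N.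
Proof.
rewrite inE/=; apply/mapP/andP => [[l + [-> ->]]|[/eqP -> jn]].
  by rewrite mem_iota.
by exists j; rewrite ?mem_iota.
Qed.

Lemma mem_rows i n k j : ((k, j) \in rows i n) = (k < i)%N && (j < n)%N.
Proof.
rewrite inE/=; apply/allpairsP/andP => [[[a b]/= [+ + [-> ->]]]|[ki jn]].
  by rewrite !mem_iota.
by exists (k, j); rewrite /= !mem_iota.
Qed.

Lemma disjoint_rows_row i n : [disjoint rows i n & row i n]%fset.
Proof.
apply/fdisjointP => -[k j]; rewrite mem_rows mem_row => /andP[ki _].
by rewrite negb_and neq_ltn ki.
Qed.

(* [exp_prod 1 n i] is the i-th summand of Z_n, and [exp_prod t n i] its t-th
   power. *)
Definition exp_prod t n i (w : T') := \prod_(j < n) expR (t * Xs (i, j : nat) w).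

Lemma adapted_exp_prod (J : {fset nat * nat}) t n i :
  (forall j, (j < n)%N -> (i, j) \in J) -> adapted Xs J (exp_prod t n i).
Proof.
move=> iJ; apply: measurable_prod => j _; apply: measurableT_comp => //.
by apply: measurable_funM => //; apply: adapted_component; exact: iJ.
Qed.

Lemma measurable_exp_prod t n i : measurable_fun [set: T'] (exp_prod t n i).
Proof.
apply: (@adapted_measurable _ _ _ _ _ Xs (row i n)).
by apply: adapted_exp_prod => j jn; rewrite mem_row eqxx.
Qed.

(** Induction on the number of factors: the index [(i, n)] of the new factor lies outside [row i n],
    so expectations multiply. *)
Lemma exp_prod_moment t n i : 0 <= t ->
  L1 (exp_prod t n i) /\ \int[Q]_w exp_prod t n i w = M t ^+ n.
Proof.
move=> t0; elim: n => [|n [IL IE]].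
  rewrite (_ : exp_prod t 0 i = fun=> 1); last first.
    by apply/funext => w; rewrite /exp_prod big_ord0.
  by split; [exact: L1_cst|rewrite Rint_cst].
have [L E] := copy_expRM (i, n) t0.
have eS : exp_prod t n.+1 i = (fun w => exp_prod t n i w * expR (t * Xs (i, n) w)).
  by apply/funext => w; rewrite /exp_prod big_ord_recr.
have ind : indep Q (exp_prod t n i) (fun w => expR (t * Xs (i, n) w)).
  apply: (adapted_indep copies.1 (J := row i n) (K := [fset (i, n)]%fset)).
  - by apply/fdisjointP => -[k j]; rewrite mem_row inE xpair_eqE => /andP[_ jn];
      rewrite negb_and (ltn_eqF jn) orbT.
  - by apply: adapted_exp_prod => j jn; rewrite mem_row eqxx.
  - apply: measurableT_comp => //; apply: measurable_funM => //.
    by apply: adapted_component; rewrite inE.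
have mE := measurable_exp_prod t n i.
have mX := measurable_expRM (Xs (i, n)) t.
rewrite eS; split; first exact: L1_indepM mE mX ind IL L.
by rewrite (Rint_indepM mE mX ind IL L) IE E exprSr.
Qed.

Lemma exp_prodE t n i w : exp_prod t n i w = exp_prod 1 n i w `^ t.
Proof.
rewrite /exp_prod -!expR_sum -expRM; congr expR.
by rewrite mulr_suml; apply: eq_bigr => j _; ring.
Qed.

Lemma exp_prod_ge0 t n i w : 0 <= exp_prod t n i w.
Proof. by apply: prodr_ge0 => j _; exact: expR_ge0. Qed.

Definition centered n i w := exp_prod 1 n i w - M 1 ^+ n.

Lemma measurable_centered n i : measurable_fun [set: T'] (centered n i).
Proof. by apply: measurable_funB => //; exact: measurable_exp_prod. Qed.

Lemma centered_mean n i : L1 (centered n i) /\ \int[Q]_w centered n i w = 0.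
Proof.
have [L E] := exp_prod_moment n i ler01.
split; first by apply: L1B => //; exact: L1_cst.
by rewrite RintegralB//; [rewrite Rint_cst E subrr|exact: L1_cst].
Qed.

Lemma centered_variance n i : L1 (fun w => centered n i w ^+ 2) /\
  \int[Q]_w (centered n i w ^+ 2) = M 2 ^+ n - (M 1 ^+ n) ^+ 2.
Proof.
have [L E] := exp_prod_moment n i ler01.
have [L2 E2] := exp_prod_moment n i (ler0n R 2).
have e w : centered n i w ^+ 2 = exp_prod 2 n i w -
    2 * M 1 ^+ n * exp_prod 1 n i w + (M 1 ^+ n) ^+ 2.
  rewrite /centered (exp_prodE 2) powR_mulrn ?exp_prod_ge0//; ring.
have LZ := L1Zl (2 * M 1 ^+ n) L.
have LC := L1_cst Q ((M 1 ^+ n) ^+ 2).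
have LB := L1B L2 LZ.
rewrite (_ : (fun w => centered n i w ^+ 2) = (fun w => exp_prod 2 n i w -
    2 * M 1 ^+ n * exp_prod 1 n i w + (M 1 ^+ n) ^+ 2)); last exact/funext.
split; first exact: L1D.
rewrite RintegralD// RintegralB// RintegralZl// Rint_cst E E2; ring.
Qed.

(** A difference of two nonnegative numbers is at most the larger one in absolute value, so its
    [q]-th power is at most the sum of their [q]-th powers. *)
Lemma centered_abs_moment q n i : 0 <= q ->
  L1 (fun w => `|centered n i w| `^ q) /\
  \int[Q]_w (`|centered n i w| `^ q) <= M q ^+ n + (M 1 ^+ n) `^ q.
Proof.
move=> q0; have [L E] := exp_prod_moment n i q0.
have m0 : 0 <= M 1 ^+ n.
  by rewrite exprn_ge0// ltW// (mgf_gt0 fin_cumulant).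
have le w : `|(`|centered n i w| `^ q)| <= exp_prod q n i w + (M 1 ^+ n) `^ q.
  rewrite ger0_norm ?powR_ge0// (exp_prodE q).
  have W0 := exp_prod_ge0 1 n i w.
  have [h|h] := leP (M 1 ^+ n) (exp_prod 1 n i w).
    apply: (@le_trans _ _ (exp_prod 1 n i w `^ q)); last by rewrite lerDl powR_ge0.
    apply: ge0_ler_powR; rewrite ?nnegrE// /centered ger0_norm ?subr_ge0//.
    by rewrite gerBl.
  apply: (@le_trans _ _ ((M 1 ^+ n) `^ q)); last by rewrite lerDr powR_ge0.
  apply: ge0_ler_powR; rewrite ?nnegrE// /centered ltr0_norm ?subr_lt0//.
  by rewrite opprB gerBl.
have LR : L1 (fun w => exp_prod q n i w + (M 1 ^+ n) `^ q).
  by apply: L1D => //; exact: L1_cst.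
have LL : L1 (fun w => `|centered n i w| `^ q).
  apply: L1_le LR le; apply: (measurableT_comp (measurable_powR q)).
  by apply: measurableT_comp => //; exact: measurable_centered.
split=> //; apply: (@le_trans _ _
    (\int[Q]_w (exp_prod q n i w + (M 1 ^+ n) `^ q))).
  by apply: Rint_le => // w; exact: le_trans (ler_norm _) (le w).
by rewrite RintegralD// ?Rint_cst ?E//; exact: L1_cst.
Qed.

Lemma centered_indep (a : R) n i :
  indep Q (fun w => \sum_(k < i) a * centered n k w) (fun w => a * centered n i w).
Proof.
have ad (J : {fset nat * nat}) k : (forall j, (j < n)%N -> (k, j) \in J) ->
    adapted Xs J (fun w => a * centered n k w).
  move=> kJ; apply: measurable_funM => //; apply: measurable_funB => //.
  exact: adapted_exp_prod.
apply: (adapted_indep copies.1 (disjoint_rows_row i n)).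
  rewrite /adapted.
  (* [measurable_sum] asks for adaptedness of every term of the family, also of those with index at
     least [i]; these are set to zero. *)
  rewrite (_ : (fun w => _) = (fun w => \sum_(0 <= k < i)
      (if (k < i)%N then a * centered n k w else 0))); last first.
    apply/funext => w; rewrite big_mkord.
    by apply: eq_bigr => k _; rewrite ltn_ord.
  apply: measurable_sum => k; case: ltnP => // ki.
  by apply: ad => j jn; rewrite mem_rows ki.
by apply: ad => j jn; rewrite mem_row eqxx.
Qed.

Lemma centered_sum_variance n N :
  L1 (fun w => (\sum_(i < N) centered n i w) ^+ 2) /\
  \int[Q]_w ((\sum_(i < N) centered n i w) ^+ 2) =
    N%:R * (M 2 ^+ n - (M 1 ^+ n) ^+ 2).
Proof.
have mS k : measurable_fun [set: T'] (fun w => \sum_(i < k) centered n i w).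
  by apply: measurable_sum => i; exact: measurable_centered.
have LS k : L1 (fun w => \sum_(i < k) centered n i w).
  by apply: L1_sum => i _; have [] := centered_mean n i.
elim: N => [|N [LN EN]].
  rewrite (_ : (fun w => _) = fun=> 0); last first.
    by apply/funext => w; rewrite big_ord0 expr0n.
  by rewrite Rint_cst mul0r; split=> //; exact: L1_cst.
have [LD ED] := centered_mean n N; have [LD2 ED2] := centered_variance n N.
have ind : indep Q (fun w => \sum_(i < N) centered n i w) (centered n N).
  have := centered_indep 1 n N.
  rewrite (_ : (fun w => 1 * centered n N w) = centered n N); last first.
    by apply/funext => w; rewrite mul1r.
  rewrite (_ : (fun w => \sum_(k < N) 1 * centered n k w) =
    (fun w => \sum_(k < N) centered n k w))//.
  by apply/funext => w; apply: eq_bigr => k _; rewrite mul1r.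
have mD := measurable_centered n N.
have LP := L1_indepM (mS N) mD ind (LS N) LD.
have EP := Rint_indepM (mS N) mD ind (LS N) LD.
rewrite ED mulr0 in EP.
have L2P := L1Zl 2 LP; have LA := L1D LN L2P.
have e w : (\sum_(i < N.+1) centered n i w) ^+ 2 =
    (\sum_(i < N) centered n i w) ^+ 2 +
    2 * (\sum_(i < N) centered n i w * centered n N w) + centered n N w ^+ 2.
  by rewrite big_ord_recr/= sqrrD -mulr_suml mulr_natl.
rewrite (_ : (fun w => _) = (fun w => (\sum_(i < N) centered n i w) ^+ 2 +
    2 * ((\sum_(i < N) centered n i w) * centered n N w) +
    centered n N w ^+ 2)); last first.
  by apply/funext => w; rewrite e mulr_suml.
split; first exact: L1D.
rewrite RintegralD// RintegralD// RintegralZl// EN EP ED2 -natr1; ring.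
Qed.

Lemma standardize_sum_prod_exp (N : nat -> nat) n w :
  standardize Q (sum_prod_exp Xs N n) w =
  \sum_(i < N n) (Num.sqrt ((N n)%:R * (M 2 ^+ n - (M 1 ^+ n) ^+ 2)))^-1 *
    centered n i w.
Proof.
have Ze x : sum_prod_exp Xs N n x =
    \sum_(i < N n) centered n i x + (N n)%:R * M 1 ^+ n.
  rewrite /centered big_split/= sumrN sumr_const card_ord mulr_natl subrK.
  by apply: eq_bigr => i _; apply: eq_bigr => j _; rewrite mul1r.
have LS : L1 (fun w => \sum_(i < N n) centered n i w).
  by apply: L1_sum => i _; have [] := centered_mean n i.
have EI : \int[Q]_x (sum_prod_exp Xs N n x) = (N n)%:R * M 1 ^+ n.
  rewrite (Rint_eq Q Ze) RintegralD//; last exact: L1_cst.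
  rewrite Rint_cst Rint_sum => [|i _]; last by have [] := centered_mean n i.
  by rewrite big1 ?add0r// => i _; have [] := centered_mean n i.
have EZ : fine ('E_Q[sum_prod_exp Xs N n])%E = (N n)%:R * M 1 ^+ n.
  by rewrite unlock; exact: EI.
have VZ : fine (variance Q (sum_prod_exp Xs N n)) =
    (N n)%:R * (M 2 ^+ n - (M 1 ^+ n) ^+ 2).
  have [_ <-] := centered_sum_variance n (N n).
  rewrite /variance unlock [in LHS]unlock -/(Rintegral _ _ _).
  apply: Rint_eq => x /=.
  by rewrite -/(Rintegral _ _ _) EI Ze addrK.
by rewrite /standardize EZ VZ Ze addrK mulrC mulr_sumr.
Qed.

End random_array.

(** * Rate of convergence *)

Lemma powRN_le (R : realType) (a x y : R) : 0 <= a -> 0 < x -> x <= y ->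
  y `^ (- a) <= x `^ (- a).
Proof.
move=> a0 x0 xy; have y0 := lt_le_trans x0 xy.
rewrite !powRN lef_pV2 ?posrE ?powR_gt0//.
by apply: ge0_ler_powR; rewrite ?nnegrE// ltW.
Qed.

Lemma cvg_expR_geometric (R : realType) (a : R) : 0 < a ->
  expR (- a * n%:R) @[n --> \oo] --> (0 : R).
Proof.
move=> a0.
rewrite (_ : (fun n : nat => _) = (fun n : nat => expR (- a) ^+ n)).
  by apply: cvg_expr; rewrite ger0_norm ?expR_ge0// expR_lt1 oppr_lt0.
by apply/funext => n; rewrite mulrC expRM_natl.
Qed.

Lemma invr_sqrt_powR (R : realType) (x q : R) : 0 < x ->
  (Num.sqrt x)^-1 `^ q = x `^ (- (q / 2)).
Proof.
move=> x0; rewrite -powR12_sqrt ?ltW// -powRN -powRrM; congr (_ `^ _).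
by field.
Qed.

Lemma expR_half_le (R : realType) (x y : R) :
  `|1 - expR (- x) * y| <= 1 / 2 -> expR x / 2 <= y.
Proof.
rewrite ler_norml => /andP[_ h].
have {}h : 1 / 2 <= (expR x)^-1 * y by rewrite -expRN; lra.
by move: h; rewrite ler_pdivlMl ?expR_gt0// mul1r.
Qed.

Section lyapunov_rate.
Context (R : realType) (m1 m2 : R).
Hypotheses (m1_gt0 : 0 < m1) (m12 : m1 ^+ 2 < m2).

Let m2_gt0 : 0 < m2.
Proof. by apply: lt_trans m12; exact: exprn_gt0. Qed.

Let kappa := 1 - m1 ^+ 2 / m2.

Let kappa_gt0 : 0 < kappa.
Proof. by rewrite subr_gt0 ltr_pdivrMr// mul1r. Qed.

(** The ratio [m1^2 / m2] is below 1, so its [n]-th power is largest at [n = 1], which defines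
    [kappa]. At [n = 0] the gap is zero. *)
Lemma expr_sqr_gap_ge n : (0 < n)%N ->
  kappa * m2 ^+ n <= m2 ^+ n - (m1 ^+ n) ^+ 2.
Proof.
case: n => // n _; rewrite /kappa mulrBl mul1r lerD2l lerN2.
rewrite exprAC [in leLHS]exprS [m2 ^+ n.+1]exprS mulrA divfK ?lt0r_neq0//.
rewrite ler_wpM2l ?sqr_ge0//.
by rewrite lerXn2r ?nnegrE ?sqr_ge0 ?(ltW m2_gt0)// ltW.
Qed.

Lemma expr_sqr_gap_gt0 n : (0 < n)%N -> 0 < m2 ^+ n - (m1 ^+ n) ^+ 2.
Proof.
by move=> n0; apply: lt_le_trans (expr_sqr_gap_ge n0); rewrite mulr_gt0 ?exprn_gt0.
Qed.

(** Here [x] stands for [N n]. Its exponent [1 - q / 2] is negative, so a lower bound on [x]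
    suffices and the rate [e] does not depend on [x]. *)
Lemma lyapunov_rate (mq q c : R) : 0 < mq -> 2 < q ->
  ln (mq) - q / 2 * ln (m2) < c * (q / 2 - 1) -> 0 < c ->
  exists e : nat -> R, e n @[n --> \oo] --> 0 /\
  forall n (x : R), (0 < n)%N -> expR (c * n%:R) / 2 <= x ->
  x `^ (1 - q / 2) * ((m2 ^+ n - (m1 ^+ n) ^+ 2) `^ (- (q / 2)) *
      (mq ^+ n + (m1 ^+ n) `^ q) + 2 * expR (q ^+ 2 / 2)) <= e n.
Proof.
move=> mq_gt0 q2 qc c0; pose h := q / 2 - 1.
have h0 : 0 < h by rewrite /h; lra.
have q0 : 0 <= q by lra.
(* Exponential decay rates of the part with [mq^n] and, for [th2], of the part with [m1^(nq)]. The
   first is positive by the choice of [q], the second because [m1^2 < m2]; the Gaussian part decays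
   at rate [c * h]. *)
pose th1 := c * h + q / 2 * ln (m2) - ln (mq).
pose th2 := c * h + q / 2 * ln (m2) - q * ln (m1).
have th1_gt0 : 0 < th1 by rewrite /th1 /h; lra.
have th2_gt0 : 0 < th2.
  have : ln (m1 ^+ 2) < ln (m2).
    by rewrite ltr_ln ?posrE ?exprn_gt0.
  rewrite lnXn// -mulr_natl => l12.
  have : q / 2 * (2 * ln (m1)) < q / 2 * ln (m2) by rewrite ltr_pM2l//; lra.
  have -> : q / 2 * (2 * ln (m1)) = q * ln (m1) by field.
  have : 0 < c * h by exact: mulr_gt0.
  by rewrite /th2; lra.
(* The price of the factor [1/2] in the lower bound for [x]. *)
pose C : R := 2 `^ h.
exists (fun n => C * (kappa `^ (- (q / 2)) *
   (expR (- th1 * n%:R) + expR (- th2 * n%:R)) +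
   2 * expR (q ^+ 2 / 2) * expR (- (c * h) * n%:R))); split.
  rewrite [X in _ --> X](_ : 0 = C * (kappa `^ (- (q / 2)) * (0 + 0) +
      2 * expR (q ^+ 2 / 2) * 0)); last by ring.
  apply: cvgM; [exact: cvg_cst|apply: cvgD].
    apply: cvgM; [exact: cvg_cst|].
    by apply: cvgD; exact: cvg_expR_geometric.
  apply: cvgM; [exact: cvg_cst|apply: cvg_expR_geometric].
  exact: mulr_gt0.
move=> n x n0 nx.
have e0 : 0 < expR (c * n%:R) / 2 by rewrite divr_gt0 ?expR_gt0.
have A : x `^ (1 - q / 2) <= C * expR (- (c * h) * n%:R).
  rewrite (_ : 1 - q / 2 = - h); last by rewrite /h; ring.
  apply: le_trans (powRN_le (ltW h0) e0 nx) _.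
  rewrite powRM ?expR_ge0// -expRM -powR_inv1// -powRrM mulrC.
  rewrite le_eqVlt; apply/orP; left; apply/eqP; congr (_ `^ _ * expR _); ring.
have lnE (y : R) : 0 < y -> y ^+ n = expR (ln y * n%:R).
  by move=> y0; rewrite mulrC expRM_natl lnK.
have B : (m2 ^+ n - (m1 ^+ n) ^+ 2) `^ (- (q / 2)) <=
    kappa `^ (- (q / 2)) * expR (- (q / 2 * ln (m2)) * n%:R).
  have k0 : 0 < kappa * m2 ^+ n by rewrite mulr_gt0 ?exprn_gt0.
  apply: le_trans (powRN_le _ k0 (expr_sqr_gap_ge n0)) _; first by lra.
  rewrite powRM ?exprn_ge0 ?(ltW m2_gt0) ?(ltW kappa_gt0)// lnE// -expRM.
  rewrite le_eqVlt; apply/orP; left; apply/eqP; congr (_ * expR _); ring.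
have D : mq ^+ n + (m1 ^+ n) `^ q =
    expR (ln (mq) * n%:R) + expR (q * ln (m1) * n%:R).
  rewrite lnE// lnE// -expRM; congr (_ + expR _); ring.
have D0 : 0 <= mq ^+ n + (m1 ^+ n) `^ q.
  by rewrite D addr_ge0// expR_ge0.
have F0 : 0 <= 2 * expR (q ^+ 2 / 2) by rewrite mulr_ge0 ?expR_ge0.
rewrite (le_trans (ler_wpM2r _ A))//.
  by rewrite addr_ge0// mulr_ge0// powR_ge0.
rewrite -[leLHS]mulrA ler_wpM2l ?powR_ge0// mulrDr.
apply: lerD; last by rewrite mulrC.
apply: le_trans (ler_wpM2l (expR_ge0 _) (ler_wpM2r D0 B)) _.
rewrite D le_eqVlt; apply/orP; left; apply/eqP.
rewrite -[X in _ * X = _]mulrA mulrCA; congr (_ * _).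
rewrite mulrA -expRD mulrDr -!expRD /th1 /th2.
by congr (expR _ + expR _); ring.
Qed.

End lyapunov_rate.

(** * The Lyapunov bound for one standardized row *)

Section row_lindeberg.
Context (R : realType) (d : measure_display) (T : measurableType d)
  (P : probability T R) (X : {RV P >-> R})
  (d' : measure_display) (T' : measurableType d') (Q : probability T' R)
  (Xs : nat * nat -> {RV Q >-> R}).
Hypothesis fin_cumulant :
  forall t : R, 0 <= t -> cumulant_gen_fun P X t \is a fin_num.
Hypothesis copies : independent_copies X Xs.
Hypothesis nondeg : non_degenerate X.
Local Notation M := (mgf X).

Lemma row_lindeberg (q : R) (N : nat -> nat) n : 0 <= q -> (0 < n)%N -> (0 < N n)%N ->
  forall K f0 f1 f2, taylor2 q K f0 f1 f2 ->
  `|\int[lebesgue_measure]_y (f0 y * normal_pdf 0 1 y) -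
    \int[Q]_w f0 (standardize Q (sum_prod_exp Xs N n) w)| <=
  K * ((N n)%:R `^ (1 - q / 2) * ((M 2 ^+ n - (M 1 ^+ n) ^+ 2) `^ (- (q / 2)) *
      (M q ^+ n + (M 1 ^+ n) `^ q) + 2 * expR (q ^+ 2 / 2))).
Proof.
move=> q0 n0 N0 K f0 f1 f2 ft.
set v := M 2 ^+ n - (M 1 ^+ n) ^+ 2.
have v0 : 0 < v.
  exact: expr_sqr_gap_gt0 (mgf_gt0 fin_cumulant ler01)
    (mgf1_sqr_lt fin_cumulant nondeg) _ n0.
have NR : 0 < (N n)%:R :> R by rewrite ltr0n.
set a := (Num.sqrt ((N n)%:R * v))^-1.
have a0 : 0 < a by rewrite invr_gt0 sqrtr_gt0 mulr_gt0.
(* After scaling by [a] each of the [N n] summands has variance [1 / N n], so [s] is the scale of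
   the normal variables that replace them. *)
pose s : R := (Num.sqrt (N n)%:R)^-1.
have s0 : 0 < s by rewrite invr_gt0 sqrtr_gt0.
have s2 : s ^+ 2 = (N n)%:R^-1 by rewrite exprVn sqr_sqrtr ?ltW.
have a2 : a ^+ 2 * v = s ^+ 2.
  rewrite s2 exprVn sqr_sqrtr ?ltW ?mulr_gt0// invfM -mulrA mulVf ?mulr1//.
  exact: lt0r_neq0.
under [X in `|_ - X|]eq_Rintegral do
  rewrite (standardize_sum_prod_exp fin_cumulant copies).
pose b := a `^ q * (M q ^+ n + (M 1 ^+ n) `^ q).
pose Y i w := a * centered X Xs n i w.
have mC i := measurable_centered X Xs n i.
have [IC EC] : (forall i, Q.-integrable [set: T'] (EFin \o centered X Xs n i)) /\
    (forall i, \int[Q]_w centered X Xs n i w = 0).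
  by split=> i; have [] := centered_mean fin_cumulant copies n i.
have e2 i : (fun w => Y i w ^+ 2) = (fun w => a ^+ 2 * centered X Xs n i w ^+ 2).
  by apply/funext => w; rewrite exprMn.
have eq i : (fun w => `|Y i w| `^ q) =
    (fun w => a `^ q * (`|centered X Xs n i w| `^ q)).
  by apply/funext => w; rewrite normrM (gtr0_norm a0) powRM// ltW.
have := @lindeberg_normal _ _ _ Q q s b Y (N n) s0 q0.
rewrite s2 divff ?lt0r_neq0// => /(_ erefl) H.
have {H} := H _ _ _ _ _ _ _ _ K f0 f1 f2 ft.
move=> H; apply: le_trans (H _ _ _ _ _ _ _ _) _ => {H}.
- by move=> i; exact: measurable_funM.
- by move=> i; exact: L1Zl.
- move=> i; rewrite e2; apply: L1Zl.
  by have [] := centered_variance fin_cumulant copies n i.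
- move=> i; rewrite eq; apply: L1Zl.
  by have [] := centered_abs_moment fin_cumulant copies n i q0.
- by move=> i; rewrite RintegralZl// EC mulr0.
- move=> i; rewrite e2; have [L E] := centered_variance fin_cumulant copies n i.
  by rewrite RintegralZl// E -/v -s2.
- move=> i; rewrite eq.
  have [L E] := centered_abs_moment fin_cumulant copies n i q0.
  by rewrite RintegralZl// ler_wpM2l// powR_ge0.
- by move=> i; exact: centered_indep.
rewrite le_eqVlt; apply/orP; left; apply/eqP.
have -> : (N n)%:R `^ (1 - q / 2) = (N n)%:R * (N n)%:R `^ (- (q / 2)) :> R.
  rewrite powRD; first by rewrite powRr1// ltW.
  by apply/implyP => _; exact: lt0r_neq0.
rewrite /b /a /s !invr_sqrt_powR ?mulr_gt0// powRM ?ltW//.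
by ring.
Qed.

End row_lindeberg.


Unset Implicit Arguments.

Theorem theorem1 (R : realType)
    (d : measure_display) (T : measurableType d) (P : probability T R)
    (X : {RV P >-> R})
    (d' : measure_display) (T' : measurableType d') (Q : probability T' R)
    (Xs : nat * nat -> {RV Q >-> R})
    (N : nat -> nat) (c : R) :
  let phi : R -> \bar R := cumulant_gen_fun P X in
  let Z : nat -> {RV Q >-> R} := fun n => sum_prod_exp Xs N n in
  let c2 : R := 2 * derive1 (fine \o phi) 2 - fine (phi 2) in
  non_degenerate X ->
  (forall t : R, 0 <= t -> phi t \is a fin_num) ->
  independent_copies X Xs ->
  0 < c ->
  (expR (- c * n%:R) * (N n)%:R @[n --> \oo] --> (1 : R)) ->
  c2 < c ->
  cvg_in_distribution Q (fun n => standardize Q (Z n)) (normal_prob 0 1).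
Proof.
move=> phi Z c2 nondeg fin_phi copies c0 Nc c2c.
have [q /andP[q2 q3] qc] := exists_lyapunov_exponent fin_phi c2c.
have q0 : 0 <= q by exact: le_trans (ltW q2).
have [e [e_cvg eP]] := lyapunov_rate (mgf_gt0 fin_phi ler01)
  (mgf1_sqr_lt fin_phi nondeg) (mgf_gt0 fin_phi q0) q2 qc c0.
apply: cvg_in_distribution_logistic => k a.
have q23 : 2 <= q <= 3 by rewrite q3 ltW.
have [K [f1 [f2 ft]]] := logistic_taylor2 k a q23.
have K0 : 0 <= K by have [B _ _ _] := ft; exact: bounded_lipschitz_ge0 B.
apply/cvgrPdist_le => r r0.
have Ke : K * e n @[n --> \oo] --> 0.
  by rewrite -(mulr0 K); apply: cvgM => //; exact: cvg_cst.
have /cvgrPdist_le/(_ _ r0) Ker := Ke.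
(* Tolerance [1/2] in the limit of [exp(- c n) N_n] yields the bound [N_n >= exp(c n) / 2] expected
   by [lyapunov_rate]. *)
have half : 0 < 1 / 2 :> R by rewrite divr_gt0.
have /cvgrPdist_le/(_ _ half) Nhalf := Nc.
near=> n.
have n0 : (0 < n)%N by near: n; exact: nbhs_infty_gt.
have Nn : expR (c * n%:R) / 2 <= (N n)%:R.
  by apply: expR_half_le; rewrite -(mulNr c); near: n.
have N0 : (0 < N n)%N.
  by rewrite -(ltr0n R); apply: lt_le_trans Nn; rewrite divr_gt0 ?expR_gt0.
have H := row_lindeberg fin_phi copies nondeg q0 n0 N0 ft.
apply: le_trans H _.
apply: (@le_trans _ _ (K * e n)).
  by rewrite ler_wpM2l//; exact: eP.
have : `|0 - K * e n| <= r by near: n.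
by rewrite sub0r normrN => /(le_trans (ler_norm _)).
Unshelve. all: end_near. Qed.
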